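(* Let $d\le \Delta$ be positive integers and let $p=p(n)\in[0,1]$ satisfy $$p \ge \left( n^{-1}\log^3 n \right)^{\frac{1}{2d}}.$$ Then with high probability $G_{n,p}$ is $\mathcal{H}(n,d,\Delta)$-universal.
   Context: $G_{n,p}$ is the binomial random graph on vertex set $[n]=\{1,\dots,n\}$ in which each pair of vertices is an edge independently with probability $p$. ''With high probability'' (w.h.p.) means with probability tending to $1$ as $n\to\infty$. A graph $H$ is $d$-degenerate if its vertices can be labelled $v_1,\dots,v_t$ so that each $v_i$ has at most $d$ neighbours in $\{v_1,\dots,v_{i-1}\}$. $\mathcal{H}(n,d,\Delta)$ denotes the family of all $d$-degenerate graphs on at most $n$ vertices with maximum degree at most $\Delta$. Given a family $\mathcal{H}$ of graphs, a graph $G$ is $\mathcal{H}$-universal if it contains a copy (as a not necessarily induced subgraph) of every $H\in\mathcal{H}$ (all simultaneously). *)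

(* Defs.v *)
From HB Require Import structures.
From mathcomp Require Import all_boot all_order all_algebra.
From mathcomp Require Import all_classical all_reals all_analysis.
Import Order.TTheory GRing.Theory Num.Theory.
Import numFieldNormedType.Exports.

Set Implicit Arguments.
Unset Strict Implicit.
Unset Printing Implicit Defensive.

Local Open Scope classical_set_scope.
Local Open Scope ring_scope.

(* A finite simple graph on V is a set of two-element subsets of V. *)
Record sgraph (V : finType) := SGraph {
  edges : {set {set V}};
  edges_card2 : [forall e in edges, #|e| == 2%N] }.

HB.instance Definition _ (V : finType) := [isSub for @edges V].
HB.instance Definition _ (V : finType) := [Countable of sgraph V by <:].
HB.instance Definition _ (V : finType) := [Finite of sgraph V by <:].

Section Graphs.
Variables (V : finType) (G : sgraph V).

Definition adj (x y : V) : bool := [set x; y]%SET \in edges G.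

Definition neighbours (x : V) : {set V} := [set y | adj x y]%SET.

Definition max_degree_le (Delta : nat) : Prop :=
  forall x : V, (#|neighbours x| <= Delta)%N.

Definition degenerate (d : nat) : Prop :=
  exists v : 'I_#|V| -> V, bijective v /\
    forall i : 'I_#|V|,
      (#|neighbours (v i) :&: [set v j | j : 'I_#|V| & (j < i)%N]| <= d)%N.

End Graphs.

Definition contains_copy (W V : finType) (G : sgraph W) (H : sgraph V) : Prop :=
  exists f : V -> W,
    injective f /\ forall x y : V, adj H x y -> adj G (f x) (f y).

(* A family of finite graphs, on arbitrary finite vertex types. *)
Definition graph_family := forall V : finType, sgraph V -> Prop.

Definition bounded_degenerate (n d Delta : nat) : graph_family :=
  fun V H => [/\ (#|V| <= n)%N, degenerate H d & max_degree_le H Delta].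

Definition universal (F : graph_family) (W : finType) (G : sgraph W) : Prop :=
  forall (V : finType) (H : sgraph V), F V H -> contains_copy G H.

Section BinomialRandomGraph.
Context {R : realType}.

(* Probability that G_{n,p} equals G: the pairs of vertices are edges
   independently, each with probability p. *)
Definition gnp_mass (n : nat) (p : R) (G : sgraph 'I_n) : R :=
  \prod_(e : {set 'I_n} | #|e| == 2%N) (if e \in edges G then p else 1 - p).

Definition gnp_prob (n : nat) (p : R) (A : sgraph 'I_n -> Prop) : R :=
  \sum_(G : sgraph 'I_n | `[< A G >]) gnp_mass p G.

Definition gnp_whp (p : nat -> R) (A : forall n, sgraph 'I_n -> Prop) : Prop :=
  gnp_prob (p n) (A n) @[n --> \oo] --> (1 : R).

End BinomialRandomGraph.

(* Main.v *)
Require Import Defs.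
From HB Require Import structures.
From mathcomp Require Import all_boot all_order all_algebra.
From mathcomp Require Import boolp reals zify.

Set Implicit Arguments.
Unset Strict Implicit.
Unset Printing Implicit Defensive.

(** Write q = p ^ (2 d), so that q n >= ln^3 n, and let H be a graph of the
family, padded with isolated vertices to exactly n vertices. A d-degenerate
graph satisfies e(S) <= d |S| for every vertex set S; this sparsity and the
degree bound are all that is used of H.

The embedding technique is that of Alon and Furedi. Sparsity shows that a
constant proportion of the vertices of any set S have at most 2 d neighbours
inside S. Peeling off such vertices, while keeping those peeled together at
distance at least 3, splits H into O(log n) layers; in the reverse order each
vertex has at most 2 d neighbours among those embedded before it. A layer is
embedded at once by Hall's theorem: a vertex x may go to any v adjacent to all
images of the earlier neighbours of x, and since these sets of images are
disjoint for different x, each pair (x, v) is allowed independently with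
probability at least q. A union bound (well_joined, expands_into) gives Hall's
condition simultaneously for all H: with t of order log n / q, any t of the
vertices x and any t targets contain an allowed pair, and at most t vertices x
already have enough targets in a reserved zone of 2 t vertices, one zone per
layer. As t is at most of order n / log^2 n, all the zones together are negligible.

The last layer W must fill the remaining set Y of the host exactly, so that
every v in Y has to be allowed for many w in W, whereas Y and the images of the
neighbourhoods N(w) have been chosen with knowledge of the host. Hence the sets
N(w), for a linear number of far apart w of degree at most 2 d, are embedded
first, on copies prepared in the host before H is known. The vertices outside
must still have at most 2 d earlier neighbours, so N(w) is enlarged to a block
T_w maximising an edge excess (sparse_closure). The block has bounded size, it
stays near w, and by maximality the peeling works outside the union of all the
blocks (blocks_union_sparse, many_low_degree). Bounded size leaves finitely
many isomorphism types of blocks, and by pigeonhole all w can be taken of one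
type (block_structure_exists). For each type the host contains linearly many
disjoint copies in a zone Z (copies_exist); they are selected by looking only
at the edges inside Z, so the edges from Z to the outside are still random and
every vertex outside Z sees many of the marked neighbourhoods
(Pr_no_copy_system). Using two disjoint zones Z, each for half of the blocks,
serves the vertices of Z as well. *)


(** * Systems of distinct representatives and conflict-free sets *)

Section Hall.
Variables (X Y : finType) (y0 : Y).

Let reach (F : X -> {set Y}) (S : {set X}) := \bigcup_(x in S) F x.

(** Hall's theorem. Either some nonempty proper subset of A is tight, and then
this subset and the rest of A can be treated separately, or every choice of one
representative leaves Hall's condition intact for the other points. Off A the
function takes the arbitrary value y0. *)
Lemma hall_sdr (F : X -> {set Y}) (A : {set X}) :
  (forall S : {set X}, S \subset A -> #|S| <= #|\bigcup_(x in S) F x|) ->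
  exists f : X -> Y, {in A &, injective f} /\ {in A, forall x, f x \in F x}.
Proof.
have [n] := ubnP #|A|; elim: n F A => // n IHn F A /ltnSE-leAn hallA.
have [-> | [x xA]] := set_0Vmem A.
  by exists (fun=> y0); split=> [x y|x]; rewrite inE.
pose tight (S : {set X}) := [&& S != set0, S \proper A & #|reach F S| <= #|S|].
have [/existsP[S /and3P[S0 SpA leS]] | /existsPn noT] :=
    boolP [exists S, tight S].
  have SA := proper_sub SpA.
  have [||f [f_inj fF]] := IHn F S.
  - exact: leq_trans (proper_card SpA) leAn.
  - by move=> T TS; apply: hallA; apply: subset_trans SA.
  have [||g [g_inj gF]] := IHn (fun x => F x :\: reach F S) (A :\: S).
  - rewrite cardsD (setIidPr SA).
    have := subset_leq_card SA; rewrite -card_gt0 in S0; lia.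
  - move=> T /subsetDP[TA TS].
    have := hallA (T :|: S); rewrite subUset TA SA => /(_ isT).
    rewrite cardsU disjoint_setI0 // cards0 subn0 => le1.
    have -> : \bigcup_(x0 in T) (F x0 :\: reach F S) =
              (\bigcup_(x0 in T :|: S) F x0) :\: reach F S.
      apply/setP=> y; rewrite inE; apply/bigcupP/andP=> [[z zT]|].
        rewrite inE => /andP[ny yz]; split=> //; apply/bigcupP; exists z => //.
        by rewrite inE zT.
      case=> ny /bigcupP[z]; rewrite inE => /orP[zT|zS] yz.
        by exists z => //; rewrite inE ny.
      by case/negP: ny; apply/bigcupP; exists z.
    have RS : reach F S \subset \bigcup_(x0 in T :|: S) F x0.
      by apply/bigcupsP=> z zS; apply: bigcup_sup; rewrite inE zS orbT.
    rewrite cardsD (setIidPr RS); have := subset_leq_card RS; lia.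
  exists (fun x => if x \in S then f x else g x); split=> [u v uA vA|u uA].
    have fR w : w \in S -> f w \in reach F S.
      by move=> wS; apply/bigcupP; exists w => //; apply: fF.
    have gR w : w \in A -> w \notin S -> g w \notin reach F S.
      move=> wA wS; have /gF : w \in A :\: S by rewrite inE wS.
      by rewrite inE => /andP[].

    case: ifPn => uS; case: ifPn => vS.
    - exact: f_inj.
    - by move=> E; have := gR v vA vS; rewrite -E fR.
    - by move=> E; have := gR u uA uS; rewrite E fR.
    - by apply: g_inj; rewrite inE ?uS ?vS.
  case: ifPn => uS; first exact: fF.
  have /gF : u \in A :\: S by rewrite inE uS.
  by rewrite inE => /andP[].
have [y yF] : exists y, y \in F x.
  apply/set0Pn; rewrite -card_gt0.
  have := hallA [set x]; rewrite sub1set xA cards1 => /(_ isT).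
  by rewrite big_set1.
have [||f [f_inj fF]] := IHn (fun z => F z :\ y) (A :\ x).
- by move: leAn; rewrite (cardsD1 x A) xA.
- move=> T /subsetD1P[TA xT].
  have [->|T0] := eqVneq T set0; first by rewrite cards0.
  have := noT T; rewrite /tight T0 /= properE TA /= negb_and negbK -ltnNge.
  case/orP=> [AT|ltT]; first by rewrite (subsetP AT _ xA) in xT.
  have -> : \bigcup_(z in T) (F z :\ y) = reach F T :\ y.
    apply/setP=> z; rewrite !inE; apply/bigcupP/andP=> [[w wT]|[zy]].
      by rewrite !inE => /andP[-> zw]; split=> //; apply/bigcupP; exists w.
    by case/bigcupP=> w wT zw; exists w => //; rewrite !inE zy.
  by have := cardsD1 y (reach F T); lia.
exists (fun z => if z == x then y else f z).
have fy z : z \in A -> z != x -> f z != y.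
  by move=> zA zx; have /fF : z \in A :\ x; rewrite !inE ?zx // => /andP[].
split=> [u v uA vA|u uA].
  case: eqP => [->|/eqP ux]; case: eqP => [->|/eqP vx] //.
  - by move=> E; have := fy v vA vx; rewrite -E eqxx.
  - by move=> E; have := fy u uA ux; rewrite E eqxx.
  - by apply: f_inj; rewrite !inE ?ux ?vx.
case: eqP => [->|/eqP ux] //.
by have /fF : u \in A :\ x; rewrite !inE ?ux // => /andP[].
Qed.
End Hall.

Section FarApart.
Variables (V : finType) (conf : rel V) (M : nat).
Hypotheses (conf_refl : reflexive conf) (conf_sym : symmetric conf).
Hypothesis conf_card : forall x, #|[set y | conf x y]| <= M.

(** Greedy choice: each chosen point rules out at most M points. *)
Lemma conflict_free_subset (L : {set V}) :
  exists W : {set V}, [/\ W \subset L,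
    {in W &, forall x y, conf x y -> x = y} & #|L| <= M * #|W|].
Proof.
have [n] := ubnP #|L|; elim: n L => // n IHn L /ltnSE-leLn.
have [->|[x xL]] := set_0Vmem L.
  by exists set0; split=> //; [move=> u v; rewrite inE | rewrite cards0].
have [|W [WL W_free leW]] := IHn (L :\: [set y | conf x y]).
  apply: leq_trans leLn; apply: proper_card; apply/properP; split.
    exact: subsetDl.
  by exists x; rewrite // !inE conf_refl.
have xW y : y \in W -> ~~ conf x y.
  by move/(subsetP WL); rewrite !inE => /andP[].
exists (x |: W); split.
- by rewrite subUset sub1set xL (subset_trans WL (subsetDl _ _)).
- move=> u v; rewrite !inE => /orP[/eqP->|uW] /orP[/eqP->|vW] //.
  + by rewrite (negPf (xW _ vW)).
  + by rewrite conf_sym (negPf (xW _ uW)).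
  + exact: W_free.
- have xnW : x \notin W by apply/negP=> /xW; rewrite conf_refl.
  rewrite cardsU1 xnW mulnDr muln1.
  have := cardsID [set y | conf x y] L.
  have := conf_card x; have := subset_leq_card (subsetIr L [set y | conf x y]).
  lia.
Qed.
End FarApart.

(** * Sparse graphs: boundaries, balls and closures *)

(** The average of f is at most 2 d + 1/2, whereas a point that is not counted
on the right has f at least 2 d + 1. *)
Lemma many_below_average (V : finType) (S : {set V}) (f : V -> nat) (d : nat) :
  2 * (\sum_(x in S) f x) <= (4 * d + 1) * #|S| ->
  #|S| <= (4 * d + 2) * #|[set x in S | f x <= 2 * d]|.
Proof.
set L := [set x in S | _] => le_f.
have : \sum_(x in S :\: L) (2 * d + 1) <= \sum_(x in S) f x.
  rewrite [leqRHS](bigID (mem L)) /=; apply: leq_trans (leq_addl _ _).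
  rewrite (eq_bigl (fun i => (i \in S) && (i \notin L))); last first.
    by move=> x; rewrite inE andbC.
  by apply: leq_sum => x /andP[xS]; rewrite [x \in L]inE xS /= -ltnNge addn1.
rewrite sum_nat_const => leD.
have LS : L \subset S by apply/subsetP=> x; rewrite inE => /andP[].
have := cardsD S L; rewrite (setIidPr LS) => cD.
have := subset_leq_card LS; nia.
Qed.

Section Graph.
Variables (V : finType) (e : rel V).
Hypothesis (e_sym : symmetric e).

Definition nbr x := [set y | e x y].
(** Every edge inside S counts twice in degsum S S, and every edge between
disjoint sets S and T counts once in degsum S T. *)
Definition degsum (S T : {set V}) := \sum_(x in S) #|nbr x :&: T|.

Lemma degsumE S T : degsum S T = \sum_(x in S) \sum_(y in T) e x y.
Proof.
apply: eq_bigr => x _; rewrite -sum1_card big_mkcond [RHS]big_mkcond /=.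
by apply: eq_bigr => y _; rewrite !inE; case: (e x y); case: (y \in T).
Qed.

Lemma degsumC S T : degsum S T = degsum T S.
Proof.
rewrite !degsumE exchange_big; apply: eq_bigr => y _; apply: eq_bigr => x _.
by rewrite e_sym.
Qed.

Lemma degsumUl (S S' T : {set V}) : [disjoint S & S'] ->
  degsum (S :|: S') T = degsum S T + degsum S' T.
Proof. by move=> dis; rewrite /degsum -bigU //; apply: eq_bigl => x; rewrite !inE. Qed.

Lemma degsumUr (S T T' : {set V}) : [disjoint T & T'] ->
  degsum S (T :|: T') = degsum S T + degsum S T'.
Proof. by move=> dis; rewrite degsumC degsumUl // !(degsumC S). Qed.

Lemma degsumU (S T : {set V}) : [disjoint S & T] ->
  degsum (S :|: T) (S :|: T) = degsum S S + 2 * degsum S T + degsum T T.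
Proof.
by move=> dis; rewrite degsumUl // !degsumUr // (degsumC T S); lia.
Qed.

Lemma degsum0P (S T : {set V}) :
  reflect (forall x y, x \in S -> y \in T -> ~~ e x y) (degsum S T == 0).
Proof.
rewrite degsumE sum_nat_eq0; apply: (iffP forallP) => [H x y xS yT|H x].
  have /implyP/(_ xS) := H x; rewrite sum_nat_eq0 => /forallP/(_ y).
  by rewrite yT; case: (e x y).
apply/implyP=> xS; rewrite sum_nat_eq0; apply/forallP=> y; apply/implyP=> yT.
by rewrite (negPf (H x y xS yT)).
Qed.

Lemma degsum_bigcup (I : finType) (A : {set I}) (T : I -> {set V}) S :
  degsum S (\bigcup_(i in A) T i) <= \sum_(i in A) degsum S (T i).
Proof.
rewrite /degsum exchange_big; apply: leq_sum => x _.
elim/big_rec2: _ => [|i n U _ le]; first by rewrite setI0 cards0.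
by rewrite setIUr; apply: leq_trans (leq_card_setU _ _) _; rewrite leq_add2l.
Qed.

Fixpoint ball r x : {set V} :=
  if r is r'.+1 then ball r' x :|: \bigcup_(y in ball r' x) nbr y else [set x].

Lemma ballS r x : ball r x \subset ball r.+1 x.
Proof. exact: subsetUl. Qed.

Lemma ball_mono r s x : r <= s -> ball r x \subset ball s x.
Proof.
elim: s => [|s IHs]; first by rewrite leqn0 => /eqP->.
rewrite leq_eqVlt ltnS => /orP[/eqP->//|/IHs/subset_trans]; apply.
exact: ballS.
Qed.

Lemma ball_center r x : x \in ball r x.
Proof. by apply: (subsetP (@ball_mono 0 r x _)) => //; rewrite inE. Qed.

Lemma ball_step r x y z : y \in ball r x -> e y z -> z \in ball r.+1 x.
Proof.
by move=> yB eyz; rewrite inE; apply/orP; right; apply/bigcupP; exists y;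
  rewrite ?inE.
Qed.

Lemma ball_trans r s x y z :
  y \in ball r x -> z \in ball s y -> z \in ball (r + s) x.
Proof.
move=> yB; elim: s z => [|s IHs] z /=; first by rewrite addn0 inE => /eqP->.
rewrite inE => /orP[/IHs|/bigcupP[u /IHs uB]].
  by apply/subsetP/ball_mono; rewrite addnS.
by rewrite inE addnS; apply: ball_step.
Qed.

Lemma ball_symW r x y : y \in ball r x -> x \in ball r y.
Proof.
elim: r x y => [|r IHr] x y /=; first by rewrite !inE eq_sym.
rewrite inE => /orP[/IHr|/bigcupP[z /IHr xz]].
  exact/subsetP/ballS.
rewrite inE e_sym => eyz.
by have := ball_trans (ball_step (ball_center 0 y) eyz) xz.
Qed.

Variable (Delta : nat).
Hypothesis deg_le : forall x, #|nbr x| <= Delta.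

Lemma card_ball r x : #|ball r x| <= Delta.+1 ^ r.
Proof.
elim: r => [|r IHr]; first by rewrite cards1.
have : #|\bigcup_(y in ball r x) nbr y| <= \sum_(y in ball r x) Delta.
  elim/big_rec2: _ => [|i n U _ le]; first by rewrite cards0.
  apply: leq_trans (leq_card_setU _ _) _; exact: leq_add.
rewrite sum_nat_const => le1; apply: leq_trans (leq_card_setU _ _) _.
rewrite expnS mulSn; apply: leq_add => //; apply: leq_trans le1 _.
by rewrite mulnC leq_mul2l IHr orbT.
Qed.

Lemma degsum_le S T : degsum S T <= Delta * #|S|.
Proof.
rewrite mulnC -sum_nat_const; apply: leq_sum => x _.
exact: leq_trans (subset_leq_card (subsetIl _ _)) (deg_le x).
Qed.

(** Vertices are far apart when the balls around them are disjoint: this is the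
form in which remoteness is used, and it is symmetric by definition. *)
Definition balls_meet R x y := ~~ [disjoint ball R x & ball R y].

Lemma balls_meet_refl R : reflexive (balls_meet R).
Proof.
by move=> x; apply/negP=> /disjointFr/(_ (ball_center R x)); rewrite ball_center.
Qed.

Lemma balls_meet_sym R : symmetric (balls_meet R).
Proof. by move=> x y; rewrite /balls_meet disjoint_sym. Qed.

Lemma card_balls_meet R x : #|[set y | balls_meet R x y]| <= Delta.+1 ^ (R + R).
Proof.
apply: leq_trans (card_ball (R + R) x); apply/subset_leq_card/subsetP=> y.
rewrite inE => /pred0Pn[z /andP[/= zx /ball_symW zy]]; exact: ball_trans zx zy.
Qed.

(** Pigeonhole on the spheres of radii a + 1, ..., a + #|S| + 1: one of them
misses S, and then no edge joins the part of S inside it to the rest of S. *)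
Lemma sphere_gap (S : {set V}) x a : exists j,
  a <= j <= a + #|S| /\ S :&: ball j.+1 x \subset ball j x.
Proof.
suff : forall n, (exists j, a <= j < a + n /\ S :&: ball j.+1 x \subset ball j x)
    \/ n <= #|S :&: ball (a + n) x|.
  case/(_ #|S|.+1) => [[j []]|].
    by rewrite addnS ltnS; exists j.
  move/leq_trans/(_ (subset_leq_card (subsetIl S _))); by rewrite ltnn.
elim=> [|n [[j [lej gap]]|IHn]]; first by right.
  by left; exists j; split=> //; case/andP: lej => -> /= /leq_trans; apply; rewrite leq_add2l.
have [gap|] := boolP (S :&: ball (a + n).+1 x \subset ball (a + n) x).
  by left; exists (a + n); split=> //; lia.
case/subsetPn=> y; rewrite inE => /andP[yS yB] nyB; right.
apply: leq_ltn_trans IHn _; rewrite addnS; apply: proper_card.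
apply/properP; split; first exact/setIS/ballS.
by exists y; rewrite inE yS //= (negPf nyB).
Qed.

Variable (d : nat).
Hypothesis sparse : forall S, degsum S S <= 2 * d * #|S|.

Lemma low_degree_exists (S : {set V}) : S != set0 ->
  exists2 x, x \in S & #|nbr x :&: S| <= 2 * d.
Proof.
move=> S0; have : 2 * \sum_(x in S) #|nbr x :&: S| <= (4 * d + 1) * #|S|.
  by have := sparse S; rewrite /degsum; nia.
move/many_below_average; rewrite -card_gt0 in S0; set L := [set _ in S | _] => le.
have /card_gt0P[x] : 0 < #|L| by nia.
by rewrite inE => /andP[]; exists x.
Qed.

(** Built from the end: the last vertex is one of low degree in all of T. *)
Lemma degenerate_order (T : {set V}) : exists s : seq V,
  [/\ uniq s, s =i T & forall x0 j, j < size s ->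
      #|nbr (nth x0 s j) :&: [set x in take j s]| <= 2 * d].
Proof.
have [n] := ubnP #|T|; elim: n T => // n IHn T /ltnSE-leTn.
have [->|T0] := eqVneq T set0.
  by exists [::]; split=> // x; rewrite !inE.
have [x xT low] := low_degree_exists T0.
have [|s [s_uniq sT s_low]] := IHn (T :\ x).
  by move: leTn; rewrite (cardsD1 x T) xT.
exists (rcons s x); split.
- by rewrite rcons_uniq sT !inE eqxx.
- by move=> y; rewrite mem_rcons inE sT !inE; case: eqP => // ->.
- move=> x0 j; rewrite size_rcons ltnS => lej.
  rewrite nth_rcons -cats1; case: ltngtP lej => // [ltj|->] _.
    by rewrite takel_cat ?s_low // ltnW.
  rewrite take_size_cat //; apply: leq_trans low.
  apply/subset_leq_card/setIS/subsetP=> y; rewrite inE sT !inE.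
  by case/andP.
Qed.

(** S maximises the excess 2 (degsum S S + degsum S N) - (4 d + 1) #|S|.
Comparison with the empty set bounds #|S|, because sparsity leaves only the
edges to N to make up for the last term. Comparison with larger sets shows that
no set outside has average degree above 2 d + 1/2 into itself and N :|: S.
Comparison with S :\: P excludes a part P joined neither to N nor to the rest
of S, as its excess is negative: so S stays close to N. *)
Lemma sparse_closure (N F : {set V}) : N \subset F -> exists S : {set V},
  [/\ [disjoint S & F], #|S| <= 2 * Delta * #|N|,
   forall S' : {set V}, [disjoint S' & F :|: S] ->
     2 * (degsum S' S' + degsum S' (N :|: S)) <= (4 * d + 1) * #|S'| &
   forall P : {set V}, P \subset S -> degsum P (S :\: P) = 0 -> degsum P N = 0 ->
     P = set0].
Proof.
move=> NF.
(* The excess, shifted by (4 d + 1) #|V| to make it a natural number. *)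
pose h S := 2 * (degsum S S + degsum S N) + (4 * d + 1) * #|~: S|.
pose S := [arg max_(S > set0 | [disjoint S & F]) h S].
have [SF maxS] : [disjoint S & F] /\
    forall S' : {set V}, [disjoint S' & F] -> h S' <= h S.
  rewrite /S; case: arg_maxnP => //; first by rewrite disjoint_sym -setI_eq0 setI0.
have cC (S' : {set V}) : #|~: S'| = #|V| - #|S'| by rewrite cardsCs setCK.
have cV (S' : {set V}) : #|S'| <= #|V| by apply: max_card.
exists S; split=> //.
- have := maxS set0; rewrite -setI_eq0 set0I eqxx => /(_ isT).
  rewrite /h !cC cards0 {1 2}/degsum !big_set0.
  have := degsum_le N S; rewrite degsumC; have := sparse S; have := cV S.
  nia.
- move=> S'; rewrite -setI_eq0 setIUr setU_eq0 !setI_eq0 => /andP[FS' SS'].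
  have := maxS (S :|: S'); rewrite -setI_eq0 setIUl setU_eq0 !setI_eq0 SF.
  rewrite FS' => /(_ isT); rewrite /h.
  rewrite degsumU 1?disjoint_sym // degsumUl 1?disjoint_sym //.
  rewrite (degsumUr _ (T := N)); last first.
    by apply: disjointWl NF _; rewrite disjoint_sym.
  have cU : #|S :|: S'| = #|S| + #|S'|.
    by rewrite cardsU disjoint_setI0 ?cards0 ?subn0 // disjoint_sym.
  have := cV (S :|: S'); rewrite !cC cU (degsumC S S'); nia.
- move=> P PS P0 PN.
  have dP : [disjoint S :\: P & P] by rewrite -setI_eq0 setIDAC setDIl setDv setI0.
  have := maxS (S :\: P); rewrite (disjointWl (subsetDl _ _) SF) => /(_ isT).
  rewrite /h -[in degsum S S](setID S P) (setIidPr PS) setUC.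
  rewrite degsumU // (degsumC _ P) P0.
  rewrite -[in degsum S N](setID S P) (setIidPr PS) setUC degsumUl // PN.
  rewrite !cC cardsD (setIidPr PS).
  have := sparse P; have := subset_leq_card PS; have := cV S => cS cPS sP maxP.
  by apply/eqP; rewrite -cards_eq0; nia.
Qed.

(** The closure of nbr w stays near w: some sphere of bounded radius misses it,
and the part outside that sphere is empty by the last clause of
sparse_closure. *)
Lemma local_block (w : V) : #|nbr w| <= 2 * d -> ~~ e w w -> exists T : {set V},
  [/\ nbr w \subset T, w \notin T, T \subset ball (4 * d * Delta).+1 w,
   #|T| <= 2 * d + 4 * d * Delta &
   forall S' : {set V}, [disjoint S' & w |: T] ->
     2 * (degsum S' S' + degsum S' T) <= (4 * d + 1) * #|S'|].
Proof.
move=> degw irr.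
have [S [SF cardS closS compS]] := @sparse_closure (nbr w) (w |: nbr w) (subsetUr _ _).
have NB j : nbr w \subset ball j.+1 w.
  by apply/subsetP=> y; rewrite inE; apply: ball_step; apply: ball_center.
exists (nbr w :|: S); split.
- exact: subsetUl.
- rewrite !inE (negPf irr) /=; apply/negP=> wS.
  by have := disjointFr SF wS; rewrite !inE eqxx.
- rewrite subUset NB.
  have [[|j] [/andP[//_ lej] gap]] := sphere_gap S w 1.
  have jD : j.+1 <= (4 * d * Delta).+1 by nia.
  apply: subset_trans (ball_mono w jD).
  rewrite -setD_eq0; apply/eqP/compS; first exact: subsetDl.
  + apply/eqP/degsum0P=> x y; rewrite !inE negb_and !negbK => /andP[nx xS].
    case/andP=> yBS yS; have yB : y \in ball j.+1 w.
      by move: yBS; rewrite yS orbF !inE.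
    apply/negP; rewrite e_sym => /(ball_step yB) xB.
    have /(subsetP gap) : x \in S :&: ball j.+2 w by rewrite inE xS.
    by rewrite !inE (negPf nx).
  + apply/eqP/degsum0P=> x y; rewrite inE => /andP[nx xS] yN.
    apply/negP; rewrite e_sym => /(ball_step (subsetP (NB j) y yN)) xB.
    have /(subsetP gap) : x \in S :&: ball j.+2 w by rewrite inE xS.
    by rewrite (negPf nx).
- apply: leq_trans (leq_card_setU _ _) _; nia.
- by move=> S' disS'; apply: closS; rewrite -setUA.
Qed.

Section UnionOfBlocks.
Variables (K r R : nat) (W : {set V}) (T : V -> {set V}).
Hypothesis T_ball : forall w, w \in W -> T w \subset ball r w.
Hypothesis T_card : forall w, w \in W -> #|T w| <= K.
Hypothesis T_closed : forall w, w \in W -> forall S : {set V}, [disjoint S & w |: T w] ->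
  2 * (degsum S S + degsum S (T w)) <= (4 * d + 1) * #|S|.
Hypothesis W_far : {in W &, forall w w', balls_meet R w w' -> w = w'}.
Hypothesis R_big : r.+2 + 2 * Delta * K <= R.

(** Induction on #|S|. If S is joined to T w but has few vertices near w, some
sphere around w misses S; the part of S inside it is joined to no other block
and to no other vertex of S, and T_closed bounds its contribution, so it can be
removed. When no such w is left, each block that meets an edge into S receives
at most Delta * K such edges and has at least twice as many vertices of S in the
ball around it; these balls are disjoint, so that the blocks contribute at most
#|S| / 2 in total. *)
Lemma blocks_union_sparse (S : {set V}) : [disjoint S & W :|: \bigcup_(w in W) T w] ->
  2 * (degsum S S + \sum_(w in W) degsum S (T w)) <= (4 * d + 1) * #|S|.
Proof.
have [n] := ubnP #|S|; elim: n S => // n IHn S /ltnSE-leSn disS.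
have disw w : w \in W -> [disjoint S & w |: T w].
  move=> wW; apply: disjointWr disS; rewrite subUset sub1set inE wW /=.
  by rewrite subsetU // bigcup_sup ?orbT.
have far w u x : w \in W -> u \in W -> x \in ball R w -> x \in ball R u -> w = u.
  move=> wW uW xw xu; apply: W_far => //; apply/negP=> /disjointFr/(_ xw).
  by rewrite xu.
have [/existsP[w /and3P[wW smallw posw]]|/existsPn big] := boolP
    [exists w, [&& w \in W, #|S :&: ball R w| < 2 * Delta * K & degsum S (T w) != 0]].
  have [j [/andP[lerj lejR] gap0]] := sphere_gap (S :&: ball R w) w r.+1.
  have ltjR : j < R by lia.
  have gap x : x \in S -> x \in ball j.+1 w -> x \in ball j w.
    move=> xS xB; apply: (subsetP gap0); rewrite !inE xS -in_setU xB andbT /=.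
    exact: (subsetP (ball_mono _ ltjR)).
  pose Q := S :&: ball j w; pose S' := S :\: ball j w.
  have SE : S = Q :|: S' by rewrite setID.
  have dQ : [disjoint Q & S'].
    rewrite -setI_eq0; apply/eqP/setP=> x; rewrite !inE.
    by case: (x \in ball _ _); rewrite ?andbF.
  have TQ x y : x \in S -> y \in T w -> e x y -> x \in Q.
    move=> xS /(subsetP (T_ball wW)) yB; rewrite e_sym inE xS => /(ball_step yB).
    exact/subsetP/ball_mono.
  have Q0 : Q != set0.
    apply: contraNneq posw => Q0; apply/degsum0P=> x y xS yT; apply/negP.
    by move=> /(TQ x y xS yT); rewrite Q0 inE.
  have cS : #|S| = #|Q| + #|S'| by rewrite cardsID.
  have lt : #|S'| < #|S| by rewrite cS; rewrite -card_gt0 in Q0; lia.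
  have := IHn S' (leq_trans lt leSn) (disjointWl (subsetDl _ _) disS).
  have := T_closed wW (disjointWl (subsetIl S (ball j w)) (disw w wW)).
  rewrite -/Q.
  have QS' : degsum Q S' = 0.
    apply/eqP/degsum0P=> x y; rewrite !inE => /andP[xS xB] /andP[nyB yS].
    by apply: contra nyB => exy; apply: gap => //; apply: ball_step exy.
  have -> : degsum S S = degsum Q Q + degsum S' S'.
    by rewrite {1 2}SE degsumU // QS'; lia.
  suff -> : \sum_(u in W) degsum S (T u) =
      degsum Q (T w) + \sum_(u in W) degsum S' (T u) by rewrite cS; nia.
  rewrite (bigD1 w) //= [X in _ = _ + X](bigD1 w) //=.
  have -> : degsum S' (T w) = 0.
    apply/eqP/degsum0P=> x y; rewrite inE => /andP[nxB xS] yT; apply/negP.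
    by move=> /(TQ _ _ xS yT); rewrite inE (negPf nxB) andbF.
  rewrite add0n [in degsum S (T w)]SE degsumUl // (_ : degsum S' (T w) = 0); last first.
    apply/eqP/degsum0P=> x y; rewrite inE => /andP[nxB xS] yT; apply/negP.
    by move=> /(TQ _ _ xS yT); rewrite inE (negPf nxB) andbF.
  rewrite addn0; congr (_ + _); apply: eq_bigr => u /andP[uW uw].
  rewrite {1}SE degsumUl // (_ : degsum Q (T u) = 0) //.
  apply/eqP/degsum0P=> x y; rewrite inE => /andP[xS xB] yT; apply/negP.
  rewrite e_sym => /(ball_step (subsetP (T_ball uW) _ yT)) xu.
  case/eqP: uw; apply: (@far u w x) => //.
    by apply: (subsetP (ball_mono _ _)) xu; lia.
  by apply: (subsetP (ball_mono _ _)) xB; lia.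
have le1 w : w \in W -> 2 * degsum S (T w) <= #|S :&: ball R w|.
  move=> wW; have := big w; rewrite wW /= negb_and negbK -leqNgt.
  case/orP=> [leM|/eqP->]; last by rewrite muln0.
  have := degsum_le (T w) S; rewrite degsumC; have := T_card wW; nia.
have : \sum_(w in W) #|S :&: ball R w| <= #|S|.
  have -> : \sum_(w in W) #|S :&: ball R w| =
            \sum_(x in S) \sum_(w in W) (x \in ball R w).
    rewrite exchange_big; apply: eq_bigr => w wW; rewrite -sum1_card.
    rewrite big_mkcond [RHS]big_mkcond; apply: eq_bigr => x _; rewrite inE.
    by case: (x \in S); case: (x \in ball R w).
  rewrite -[leqRHS]sum1_card; apply: leq_sum => x xS.
  have [/existsP[w /andP[wW xw]]|/existsPn no] := boolP
      [exists w, (w \in W) && (x \in ball R w)].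
    rewrite (bigD1 w) //= big1 ?addn0 ?leq_b1 // => u /andP[uW uw].
    by case xu: (x \in ball R u) => //; case/eqP: uw; apply: (@far u w x).
  by rewrite big1 // => w wW; have := no w; rewrite wW; case: (x \in ball R w).
have : 2 * \sum_(w in W) degsum S (T w) <= \sum_(w in W) #|S :&: ball R w|.
  by rewrite big_distrr; apply: leq_sum => w; apply: le1.
have := sparse S; nia.
Qed.

Lemma many_low_degree (S : {set V}) (X := \bigcup_(w in W) T w) : [disjoint S & W :|: X] ->
  #|S| <= (4 * d + 2) * #|[set x in S | #|nbr x :&: (X :|: S)| <= 2 * d]|.
Proof.
move=> disS; apply: many_below_average; apply: leq_trans (blocks_union_sparse disS).
rewrite leq_mul2l /=; apply: leq_trans (_ : degsum S S + degsum S X <= _); last first.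
  by rewrite leq_add2l degsum_bigcup.
rewrite /degsum -big_split; apply: leq_sum => x _ /=.
rewrite setIUr addnC; exact: leq_card_setU.
Qed.
End UnionOfBlocks.
End Graph.

(** * Far apart blocks of one type *)

(** A graph on 'I_K with a set of marked vertices; the marked vertices stand for
the neighbours of the vertex w around which the block is built. *)
Definition block_type (K : nat) : finType :=
  ({ffun 'I_K * 'I_K -> bool} * {set 'I_K})%type.

Definition block_edge K (tau : block_type K) (i j : 'I_K) := tau.1 (i, j).

(** The order of 'I_K serves as the order in which a copy is built in the host,
hence the bound on the number of earlier neighbours. *)
Definition valid_type K d (tau : block_type K) : bool :=
  (#|tau.2| <= d) && [forall j : 'I_K, #|[set i : 'I_K | (i < j) && block_edge tau i j]| <= d].

Lemma pigeonhole (V C : finType) (c0 : C) (col : V -> C) (W : {set V}) :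
  exists c, #|W| <= #|C| * #|[set x in W | col x == c]|.
Proof.
pose c := [arg max_(c > c0) #|[set x in W | col x == c]|].
exists c; rewrite -[leqLHS]sum1_card (partition_big col predT) //=.
rewrite -sum_nat_const; apply: leq_sum => c' _; rewrite /c.
case: arg_maxnP => //= c1 _ /(_ c' isT); apply: leq_trans.
by rewrite -sum1_card; apply/eq_leq/eq_bigl => x; rewrite inE.
Qed.

Section Structure.
Variables (V : finType) (e : rel V) (d Delta : nat).
Hypotheses (e_sym : symmetric e) (e_irr : irreflexive e).
Hypothesis deg_le : forall x, #|nbr e x| <= Delta.
Hypothesis sparse : forall S, degsum e S S <= 2 * d * #|S|.

(** Such vertices can be embedded simultaneously: they do not constrain each
other, and the images of their neighbourhoods are disjoint. *)
Definition spread (L : {set V}) :=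
  {in L &, forall x y, x != y -> ~~ e x y /\ [disjoint nbr e x & nbr e y]}.

Lemma far_spread R (L : {set V}) : 0 < R ->
  {in L &, forall x y, balls_meet e R x y -> x = y} -> spread L.
Proof.
move=> R0 far x y xL yL xy.
have nR z : z \in ball e R x -> z \notin ball e R y.
  by move=> zx; apply: contra xy => zy; apply/eqP/far => //;
     apply/negP=> /disjointFr/(_ zx); rewrite zy.
have step u v : e u v -> v \in ball e R u.
  by move=> /(ball_step (ball_center e 0 u)); apply/subsetP/ball_mono.
split.
  apply/negP=> /step yx; have := nR _ yx; by rewrite ball_center.
rewrite -setI_eq0; apply/eqP/setP=> z; rewrite !inE; apply/negP=> /andP[xz yz].
by have := nR z (step _ _ xz); rewrite step.
Qed.

(** One layer takes at least the proportion 1 / layer_factor of the vertices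
that remain. *)
Definition layer_factor := (4 * d + 2) * Delta.+1 ^ 2.

Lemma spread_layer (S D : {set V}) :
    #|S| <= (4 * d + 2) * #|[set x in S | #|nbr e x :&: D| <= 2 * d]| ->
  exists L : {set V}, [/\ L \subset S, spread L,
    forall x, x \in L -> #|nbr e x :&: D| <= 2 * d & #|S| <= layer_factor * #|L|].
Proof.
set Low := [set x in S | _] => leS.
have [L [LL far leL]] := conflict_free_subset (balls_meet_refl e 1) (@balls_meet_sym _ e 1)
  (card_balls_meet e_sym deg_le 1) Low.
exists L; split.
- by apply: subset_trans LL _; apply/subsetP=> x; rewrite inE => /andP[].
- exact: far_spread far.
- by move=> x /(subsetP LL); rewrite inE => /andP[].
- by apply: leq_trans leS _; rewrite /layer_factor -mulnA leq_mul2l leL orbT.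
Qed.

(** The bound of local_block, plus one to make the index type inhabited. *)
Definition block_size := (2 * d + 4 * d * Delta).+1.
(** A block reaches to distance 4 d Delta + 1; the margin covers the edges
leaving it and, in blocks_union_sparse, the search for a sphere that misses S. *)
Definition far_radius := (4 * d * Delta).+3 + 2 * Delta * block_size.
(** The product of the three losses in the selection of the blocks: low degree,
remoteness and equality of types. *)
Definition sparsity_const :=
  (4 * d + 2) * (Delta.+1 ^ (far_radius + far_radius) * #|block_type block_size|).

(** The maps idx i number the blocks in such a way that the single type tau
describes all of them. Edges and marks only have to be included in those of
tau, since this suffices to map a block into a copy of tau. *)
Record block_structure (I : finType) (tau : block_type block_size)
    (w : I -> V) (T : I -> {set V}) (idx : I -> V -> 'I_block_size) : Prop := {
  bs_valid : valid_type (2 * d) tau;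
  bs_inj : injective w;
  bs_spread : spread (w @: I);
  bs_sep : forall i j x y, x \in T i -> y \in T j -> (x == y) || e x y -> i = j;
  bs_out : forall i j, w i \notin T j;
  bs_nbr : forall i, nbr e (w i) \subset T i;
  bs_deg : forall i, #|nbr e (w i)| <= 2 * d;
  bs_idx : forall i, {in T i &, injective (idx i)};
  bs_edge : forall i, {in T i &, forall x y, e x y ->
    block_edge tau (idx i x) (idx i y)};
  bs_mark : forall i x, x \in nbr e (w i) -> idx i x \in tau.2;
  bs_low : forall S : {set V}, [disjoint S & (w @: I) :|: \bigcup_i T i] ->
    #|S| <= (4 * d + 2) *
      #|[set x in S | #|nbr e x :&: (\bigcup_i T i :|: S)| <= 2 * d]| }.

(** Vertices of degree at most 2 d are a constant proportion by sparsity, a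
constant proportion of these are pairwise far apart since balls have bounded
size, and a constant proportion of those have blocks of the same type since
there are boundedly many types. *)
Lemma block_structure_exists (I : finType) : 0 < #|I| ->
  sparsity_const * #|I| <= #|V| ->
  exists tau w T idx, @block_structure I tau w T idx.
Proof.
move=> /card_gt0P[i0 _] leI.
pose L := [set x | #|nbr e x| <= 2 * d].
have leL : #|V| <= (4 * d + 2) * #|L|.
  have := @many_below_average V setT (fun x => #|nbr e x :&: setT|) d.
  rewrite cardsT (_ : [set x in setT | _] = L); last first.
    by apply/setP=> x; rewrite !inE setIT.
  by apply; have := sparse setT; rewrite cardsT /degsum; nia.
have [W [WL far leW]] := conflict_free_subset (balls_meet_refl e far_radius)
  (@balls_meet_sym _ e far_radius) (card_balls_meet e_sym deg_le far_radius) L.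
have blocks w : exists p : {set V} * seq V, w \in W ->
    [/\ nbr e w \subset p.1, w \notin p.1, p.1 \subset ball e (4 * d * Delta).+1 w,
        #|p.1| <= 2 * d + 4 * d * Delta &
        forall S : {set V}, [disjoint S & w |: p.1] ->
          2 * (degsum e S S + degsum e S p.1) <= (4 * d + 1) * #|S|] /\
    [/\ uniq p.2, p.2 =i p.1 & forall x0 j, j < size p.2 ->
      #|nbr e (nth x0 p.2 j) :&: [set x in take j p.2]| <= 2 * d].
  have [wW|_] := boolP (w \in W); last by exists (set0, [::]).
  have degw : #|nbr e w| <= 2 * d by move/(subsetP WL): wW; rewrite inE.
  have [T HT] := local_block e_sym deg_le sparse degw (negbT (e_irr w)).
  by have [s Hs] := degenerate_order sparse T; exists (T, s).
have [B HB] := choice blocks.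
pose T w := (B w).1; pose s w := (B w).2.
(* Indices beyond the end of s w become isolated unmarked vertices. *)
pose tp w : block_type block_size :=
  ([ffun ij : 'I_block_size * 'I_block_size =>
     [&& ij.1 < size (s w), ij.2 < size (s w) &
         e (nth w (s w) ij.1) (nth w (s w) ij.2)]],
   [set i : 'I_block_size | (i < size (s w)) && (nth w (s w) i \in nbr e w)]).
have [tau leP] := pigeonhole (([ffun=> false], set0) : block_type block_size) tp W.
set P := [set x in W | _] in leP.
have leIP : #|I| <= #|P|.
  have : sparsity_const * #|I| <= sparsity_const * #|P|.
    apply: leq_trans leI _; apply: leq_trans leL _; rewrite /sparsity_const -mulnA.
    rewrite leq_mul2l; apply/orP; right; apply: leq_trans leW _.
    by rewrite -mulnA leq_mul2l leP orbT.
  rewrite leq_pmul2l // /sparsity_const muln_gt0 addn2 /= muln_gt0 expn_gt0 /=.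
  by apply/card_gt0P; exists tau.
pose w (i : I) := enum_val (widen_ord leIP (enum_rank i)).
have wP i : w i \in W /\ tp (w i) = tau.
  by have := enum_valP (widen_ord leIP (enum_rank i)); rewrite inE => /andP[? /eqP].
have w_inj : injective w.
  by move=> i j /enum_val_inj/(congr1 val)/= /val_inj /enum_rank_inj.
have wW i : w i \in W by have [] := wP i.
have sT i : s (w i) =i T (w i) by have [_ []] := HB _ (wW i).
have s_size i : size (s (w i)) < block_size.
  have [[_ _ _ cT _] [us sT' _]] := HB _ (wW i).
  by rewrite ltnS -(card_uniqP us) (eq_card sT').
pose idx i x : 'I_block_size := inord (index x (s (w i))).
have idxE i x : x \in T (w i) -> val (idx i x) = index x (s (w i)).
  rewrite -sT -index_mem => lts; rewrite /= inordK //.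
  exact: ltn_trans lts (s_size i).
have T_sub i : T (w i) \subset ball e (4 * d * Delta).+1 (w i).
  by have [[]] := HB _ (wW i).
exists tau, w, (T \o w), idx; split.
- have [[_ _ _ _ _] [us sT' low]] := HB _ (wW i0).
  have [[_ <-] sz] := (wP i0, s_size i0); rewrite -/(s _) in us sT' low.
  apply/andP; split.
    have := subsetP WL _ (wW i0); rewrite inE; apply: leq_trans.
    rewrite -(card_in_imset (f := fun i : 'I__ => nth (w i0) (s (w i0)) i)).
      apply/subset_leq_card/subsetP=> x /imsetP[i]; rewrite inE => /andP[_ ?] ->.
      done.
    move=> i j; rewrite !inE => /andP[li _] /andP[lj _] /eqP.
    by rewrite nth_uniq // => /eqP/val_inj.
  apply/forallP=> j; rewrite /block_edge.
  have [lj|gj] := ltnP j (size (s (w i0))); last first.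
    rewrite (_ : [set _ | _] = set0) ?cards0 //; apply/setP=> i.
    by rewrite !inE ffunE /= [j < _]ltnNge gj !andbF.
  apply: leq_trans (low (w i0) j lj).
  rewrite -(card_in_imset (f := fun i : 'I__ => nth (w i0) (s (w i0)) i)).
    apply/subset_leq_card/subsetP=> x /imsetP[i]; rewrite !inE ffunE /=.
    case/and4P=> ij li _ eij ->; rewrite e_sym eij /=.
    by rewrite -(nth_take _ ij) mem_nth // size_take lj.
  move=> i k; rewrite !inE !ffunE /= => /and4P[_ li _ _] /and4P[_ lk _ _] /eqP.
  by rewrite nth_uniq // => /eqP/val_inj.
- exact: w_inj.
- apply: (@far_spread far_radius); first by [].
  by move=> x y /imsetP[i _ ->] /imsetP[j _ ->]; apply: far.
- move=> i j x y xT yT exy; apply/w_inj/far => //.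
  apply/negP=> /disjointFr; have mono : (4 * d * Delta).+2 <= far_radius by rewrite /far_radius; lia.
  have yB : y \in ball e far_radius (w i).
    apply: (subsetP (ball_mono e _ mono)).
    have xB := subsetP (T_sub i) _ xT; case/orP: exy => [/eqP<-|].
      exact: (subsetP (ballS _ _ _)).
    exact: ball_step.
  move/(_ _ yB); rewrite (subsetP (ball_mono e _ _) _ (subsetP (T_sub j) _ yT)) //.
  by apply: leq_trans mono.
- move=> i j; apply/negP => /= wT.
  have [[_ nw _ _ _] _] := HB _ (wW j).
  have E : w i = w j.
    apply: far => //; apply/negP=> /disjointFr/(_ (ball_center _ _ _)).
    by rewrite (subsetP (ball_mono e _ _) _ (subsetP (T_sub j) _ wT)) // /far_radius; lia.
  by move: wT; rewrite E /T (negPf nw).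
- by move=> i; have [[]] := HB _ (wW i).
- by move=> i; have := subsetP WL _ (wW i); rewrite inE.
- move=> i x y xT yT /(congr1 val); rewrite !idxE //.
  by move=> E; rewrite -(nth_index x (s := s (w i)) (x := x)) ?sT // E nth_index ?sT.
- move=> i x y xT yT exy; have [_ <-] := wP i.
  by rewrite /block_edge ffunE /= !idxE // !index_mem !nth_index ?sT // xT yT.
- move=> i x xN; have [_ <-] := wP i.
  have xT : x \in T (w i) by have [[/subsetP/(_ x xN)]] := HB _ (wW i).
  by rewrite inE idxE // index_mem nth_index ?sT // xT xN.
- move=> S.
  have := @many_low_degree V e e_sym Delta deg_le d sparse block_size
    (4 * d * Delta).+1 far_radius (w @: I) T.
  have -> : \bigcup_(u in w @: I) T u = \bigcup_i (T \o w) i.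
    apply/setP=> x; apply/bigcupP/bigcupP=> [[u /imsetP[i _ ->] xu]|[i _ xi]].
      by exists i.
    by exists (w i) => //; apply: imset_f.
  apply.
  + by move=> u /imsetP[i _ ->].
  + by move=> u /imsetP[i _ ->]; have [[_ _ _ cT _] _] := HB _ (wW i); apply: leqW.
  + by move=> u /imsetP[i _ ->]; have [[]] := HB _ (wW i).
  + by move=> x y /imsetP[i _ ->] /imsetP[j _ ->]; apply: far.
  + by rewrite /far_radius.
Qed.
End Structure.

(** * Expansion of the host graph *)

Lemma subset_of_card (T : finType) (B : {set T}) k : k <= #|B| ->
  exists2 A : {set T}, A \subset B & #|A| = k.
Proof.
rewrite -bin_gt0 -cards_draws => /card_gt0P[A].
by rewrite inE => /andP[AB /eqP]; exists A.
Qed.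

Section Host.
Variables (U : finType) (a : rel U).

Definition sees (F : {set U}) v := F \subset nbr a v.

Definition small_family (s : nat) (I : finType) (F : I -> {set U}) (A : {set I}) :=
  [forall i in A, #|F i| <= s] &&
  [forall i in A, forall j in A, (i != j) ==> [disjoint F i & F j]].

Definition seen (I : finType) (F : I -> {set U}) (A : {set I}) (B : {set U}) :=
  [set v in B | [exists i in A, sees (F i) v]].

(** Hall's condition for small families, with B alone as the set of targets. *)
Definition expands_into (s t : nat) (B : {set U}) :=
  forall k (F : 'I_k -> {set U}), k <= t -> small_family s F setT ->
    (forall i, [disjoint F i & B]) -> k <= #|seen F setT B|.

(** For larger families this gives Hall's condition: fewer than t vertices of any
set of targets are seen by no member of the family. *)
Definition well_joined (s t : nat) :=
  forall (F : 'I_t -> {set U}) (B : {set U}), #|B| = t -> small_family s F setT ->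
    (forall i, [disjoint F i & B]) -> seen F setT B != set0.

Lemma small_familyP s (I : finType) (F : I -> {set U}) (A : {set I}) :
  reflect ({in A, forall i, #|F i| <= s} /\
           {in A &, forall i j, i != j -> [disjoint F i & F j]})
          (small_family s F A).
Proof.
apply: (iffP andP) => [[/forall_inP le /forall_inP dis]|[le dis]].
  split=> // i j iA jA ij; have /forall_inP/(_ j jA) := dis i iA.
  by rewrite ij.
split; apply/forall_inP=> // i iA; apply/forall_inP=> j jA.
by apply/implyP; apply: dis.
Qed.

Lemma expands_family s t (B : {set U}) (I : finType) (F : I -> {set U}) (A : {set I}) :
  expands_into s t B -> #|A| <= t -> small_family s F A ->
  {in A, forall i, [disjoint F i & B]} -> #|A| <= #|seen F A B|.
Proof.
move=> exp leA /small_familyP[le dis] FB.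
apply: leq_trans (exp #|A| (F \o enum_val) leA _ _) _.
- apply/small_familyP; split=> [i _|i j _ _ ij] /=; first exact/le/enum_valP.
  by apply: dis; rewrite ?enum_valP //; apply: contraNneq ij => /enum_val_inj->.
- by move=> i; apply/FB/enum_valP.
- apply/subset_leq_card/subsetP=> v; rewrite !inE => /andP[-> /= /existsP[i]].
  case/andP=> _ see; apply/existsP; exists (enum_val i); by rewrite enum_valP.
Qed.

Lemma joined_family s t (B : {set U}) (I : finType) (F : I -> {set U}) (A : {set I}) :
  well_joined s t -> t <= #|A| -> t <= #|B| -> small_family s F A ->
  {in A, forall i, [disjoint F i & B]} -> seen F A B != set0.
Proof.
move=> joined leA leB /small_familyP[le dis] FB.
pose h (i : 'I_t) : I := enum_val (widen_ord leA i).
have hA i : h i \in A by apply: enum_valP.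
have [B' B'B cB'] : exists2 B' : {set U}, B' \subset B & #|B'| = t.
  exact: subset_of_card.
have := joined (F \o h) B' cB' _ _.
rewrite -!card_gt0 => H; apply: leq_trans (H _ _) _.
- apply/small_familyP; split=> [i _|i j _ _ ij] /=; first exact/le.
  apply: dis => //; apply: contraNneq ij => /enum_val_inj/(congr1 val)/= E.
  exact/eqP/val_inj.
- by move=> i; apply: disjointWr B'B _; apply: FB.
- apply/subset_leq_card/subsetP=> v; rewrite !inE => /andP[/(subsetP B'B)-> /=].
  by case/existsP=> i /andP[_ see]; apply/existsP; exists (h i); rewrite hA.
Qed.
End Host.

(** * Extending partial embeddings *)

(** The factor 2 in cs_expand pays for halving: of a set of host vertices that
have to be covered, at least half avoid one of two disjoint zones Z. *)
Record copy_system (U : finType) (a : rel U) (K m t : nat) (Z : {set U})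
    (tau : block_type K) (c : 'I_m -> 'I_K -> U) : Prop := {
  cs_inj : forall j j' i i', c j i = c j' i' -> j = j' /\ i = i';
  cs_in : forall j i, c j i \in Z;
  cs_edge : forall j (i i' : 'I_K), i < i' -> block_edge tau i i' ->
    a (c j i) (c j i');
  cs_expand : forall A : {set U}, [disjoint A & Z] -> #|A| <= t ->
    2 * #|A| <= #|[set j | [exists v in A, sees a (c j @: tau.2) v]]| }.

Section Embedding.
Variables (V U : finType) (e : rel V) (a : rel U).
Hypotheses (e_sym : symmetric e) (e_irr : irreflexive e) (a_sym : symmetric a).

Definition partial_embedding (f : V -> U) (D : {set V}) :=
  {in D &, injective f} /\ {in D &, forall x y, e x y -> a (f x) (f y)}.

Definition back (f : V -> U) (D : {set V}) x := f @: (nbr e x :&: D).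

(** As the vertices of L are pairwise non-adjacent, embedding them amounts to
choosing distinct representatives of their sets of admissible images. *)
Lemma extend_embedding f (D L : {set V}) (Y : {set U}) :
    partial_embedding f D -> [disjoint L & D] -> spread e L ->
    [disjoint Y & f @: D] ->
    (forall A : {set V}, A \subset L -> #|A| <= #|seen a (back f D) A Y|) ->
  exists g, [/\ partial_embedding g (D :|: L), {in D, g =1 f} &
                {in L, forall x, g x \in Y}].
Proof.
move=> [f_inj f_edge] dLD spr dY hall.
have [->|[x0 _]] := set_0Vmem L.
  by exists f; rewrite setU0; split=> // x; rewrite inE.
have [|h [h_inj hP]] := @hall_sdr V U (f x0)
    (fun x => [set v in Y | sees a (back f D x) v]) L.
  move=> A AL; apply: leq_trans (hall A AL) _; apply/subset_leq_card/subsetP=> v.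
  rewrite inE => /andP[vY /existsP[x /andP[xA see]]].
  by apply/bigcupP; exists x; rewrite // inE vY.
have hY x : x \in L -> h x \in Y by move=> /hP; rewrite inE => /andP[].
have h_edge x y : x \in L -> y \in D -> e x y -> a (h x) (f y).
  move=> xL yD exy; have := hP x xL; rewrite inE => /andP[_ /subsetP see].
  have := see (f y); rewrite inE; apply.
  by apply: imset_f; rewrite !inE exy.
have hfD x y : x \in L -> y \in D -> h x != f y.
  move=> xL yD; apply: contraTneq (hY x xL) => ->.
  by rewrite (disjointFl dY) // imset_f.
exists (fun x => if x \in L then h x else f x).
have nL x : x \in D -> (x \in L) = false by apply: disjointFl dLD.
split; last by move=> x xL; rewrite /= xL; apply: hY.
  split=> x y; rewrite !inE => /orP[xD|xL] /orP[yD|yL].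
  - by rewrite !nL //; apply: f_inj.
  - rewrite nL // yL => E.
    by have := hfD y x yL xD; rewrite E eqxx.
  - rewrite (nL y) // xL => E.
    by have := hfD x y xL yD; rewrite E eqxx.
  - by rewrite xL yL; apply: h_inj.
  - by rewrite !nL //; apply: f_edge.
  - by rewrite (nL x) // yL e_sym a_sym; apply: h_edge.
  - by rewrite (nL y) // xL; apply: h_edge.
  - have [<-|xy exy] := eqVneq x y; first by rewrite e_irr.
    by have [/negP] := spr x y xL yL xy.
by move=> x xD; rewrite /= nL.
Qed.

Lemma back_small s f (D L A : {set V}) : partial_embedding f D -> spread e L ->
  {in L, forall x, #|nbr e x :&: D| <= s} -> A \subset L ->
  small_family s (back f D) A.
Proof.
move=> [f_inj _] spr low /subsetP AL; apply/small_familyP; split.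
  by move=> x /AL xL; apply: leq_trans (leq_imset_card _ _) (low x xL).
move=> x y /AL xL /AL yL xy; have [_ dis] := spr x y xL yL xy.
rewrite -setI_eq0; apply/eqP/setP=> v; rewrite !inE; apply/negP.
case/andP=> /imsetP[u + ->] /imsetP[w]; rewrite !inE.
case/andP=> xu uD /andP[yw wD] /f_inj E.
by have := disjointFr dis; move/(_ u); rewrite !inE xu E // yw => /(_ isT).
Qed.

Lemma back_disjoint f (D : {set V}) (Y Z : {set U}) x : Z \subset Y ->
  [disjoint Y & f @: D] -> [disjoint back f D x & Z].
Proof.
move=> ZY dis; rewrite disjoint_sym; apply: disjointW ZY _ dis.
exact/imsetS/subsetIr.
Qed.

Variables (s t : nat).
Hypothesis joined : well_joined a s t.

(** Small subsets of L satisfy Hall's condition inside Z; a larger subset misses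
fewer than t vertices of Y, and Y exceeds L by t. *)
Lemma extend_layer f (D L : {set V}) (Y Z : {set U}) :
    partial_embedding f D -> [disjoint L & D] -> spread e L ->
    {in L, forall x, #|nbr e x :&: D| <= s} ->
    [disjoint Y & f @: D] -> Z \subset Y -> expands_into a s t Z ->
    #|L| + t <= #|Y| ->
  exists g, [/\ partial_embedding g (D :|: L), {in D, g =1 f} &
                {in L, forall x, g x \in Y}].
Proof.
move=> f_emb dLD spr low dY ZY expZ leY; apply: extend_embedding => // A AL.
have smallA := back_small f_emb spr low AL.
have [leA|ltA] := leqP #|A| t.
  apply: leq_trans (expands_family expZ leA smallA _) _.
    by move=> x _; apply: back_disjoint ZY dY.
  apply/subset_leq_card/subsetP=> v; rewrite !inE => /andP[vZ ->].
  by rewrite (subsetP ZY).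
rewrite leqNgt; apply/negP=> ltS.
have SY : seen a (back f D) A Y \subset Y.
  by apply/subsetP=> v; rewrite inE => /andP[].
have leB : t <= #|Y :\: seen a (back f D) A Y|.
  by rewrite cardsD (setIidPr SY); have := subset_leq_card AL; lia.
have /set0Pn[v] := joined_family joined (ltnW ltA) leB smallA
  (fun x _ => back_disjoint x (subsetDl _ _) dY).
by rewrite !inE => /andP[/andP[/nandP[/negbTE->|/negbTE->]]].
Qed.
End Embedding.

(** * The spanning embedding *)

Section Spanning.
Variables (V U : finType) (e : rel V) (a : rel U) (d Delta t k0 m : nat).
Hypotheses (e_sym : symmetric e) (e_irr : irreflexive e) (a_sym : symmetric a).
Hypothesis deg_le : forall x, #|nbr e x| <= Delta.
Hypothesis sparse : forall S, degsum e S S <= 2 * d * #|S|.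
Hypothesis card_UV : #|U| = #|V|.

(* R i is reserved for the layer embedded in step i and R k0 for the final
   matching; Z b hosts the copies for the blocks with index (b, j). *)
Variables (R : nat -> {set U}) (Z : bool -> {set U}).
Hypothesis R_disj : forall i j, i <= k0 -> j <= k0 -> i != j -> [disjoint R i & R j].
Hypothesis RZ_disj : forall i b, i <= k0 -> [disjoint R i & Z b].
Hypothesis Z_disj : [disjoint Z true & Z false].
Hypothesis R_small : \sum_(i < k0.+1) #|R i| + t <= 2 * m.
Hypothesis R_expands : forall i, i <= k0 -> expands_into a (2 * d) t (R i).
Hypothesis joined : well_joined a (2 * d) t.
Hypothesis copies : forall (tau : block_type (block_size d Delta)) b,
  valid_type (2 * d) tau -> exists c, copy_system a t (Z b) tau (c : 'I_m -> _ -> U).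

Let M := layer_factor d Delta.
Hypothesis layers_enough : #|V| * M.-1 ^ k0 < M ^ k0.
Hypothesis m_gt0 : 0 < m.
Hypothesis m_small : sparsity_const d Delta * (2 * m) <= #|V|.

Let I : finType := (bool * 'I_m)%type.

Lemma M_gt0 : 0 < M.
Proof. by rewrite /M /layer_factor muln_gt0 addn2 expn_gt0. Qed.

Section WithBlocks.
Variables (tau : block_type (block_size d Delta)) (w : I -> V) (T : I -> {set V}).
Variable idx : I -> V -> 'I_(block_size d Delta).
Hypothesis blocks : block_structure e tau w T idx.
Variable c : bool -> 'I_m -> 'I_(block_size d Delta) -> U.
Hypothesis c_copies : forall b, copy_system a t (Z b) tau (c b).

Let W := w @: I.
Let X := \bigcup_i T i.

Lemma card_W : #|W| = 2 * m.
Proof.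
by rewrite card_imset; [rewrite card_prod card_bool card_ord|exact: bs_inj blocks].
Qed.

Lemma W_X_disjoint : [disjoint W & X].
Proof.
rewrite -setI_eq0; apply/eqP/setP=> x; rewrite !inE; apply/negP.
case/andP=> /imsetP[i _ ->] /bigcupP[j _].
by rewrite (negPf (bs_out blocks i j)).
Qed.

Lemma embed_blocks : exists f : V -> U, [/\ partial_embedding e a f X,
  forall i, {in T i, forall x, f x = c i.1 i.2 (idx i x)} &
  {in X, forall x, exists b, f x \in Z b}].
Proof.
pose i0 : I := (true, Ordinal m_gt0).
pose bl x := odflt i0 [pick i | x \in T i].
have blE i x : x \in T i -> bl x = i.
  rewrite /bl => xi; case: pickP => [j xj|/(_ i)]; last by rewrite xi.
  by rewrite /= (bs_sep blocks xj xi) ?eqxx.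
pose f x := c (bl x).1 (bl x).2 (idx (bl x) x).
have fE i x : x \in T i -> f x = c i.1 i.2 (idx i x).
  by move=> xi; rewrite /f (blE i).
have fZ i x : x \in T i -> f x \in Z i.1.
  by move=> xi; rewrite (fE i) //; apply: (cs_in (c_copies _)).
exists f; split=> //; last by move=> x /bigcupP[i _ /fZ]; exists i.1.
have dZ i j u : u \in Z i -> u \in Z j -> i = j.
  have ZF v : v \in Z true -> v \in Z false -> False.
    by move=> v1; rewrite (disjointFr Z_disj).
  by case: i; case: j => // ui uj; [case: (ZF u)|case: (ZF u)].
split=> x y /bigcupP[i _ xi] /bigcupP[j _ yj].
  move=> E; have Eb : i.1 = j.1.
    by apply: (dZ _ _ (f x)); [apply: fZ|rewrite E; apply: fZ].
  move: E; rewrite (fE i) // (fE j) // -Eb => /(cs_inj (c_copies _))[E2 E3].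
  have Eij : i = j by case: i j Eb E2 {xi yj E3} => [? ?] [? ?] /= -> ->.
  by rewrite -Eij in yj E3; apply: (bs_idx blocks xi yj E3).
move=> exy; have Eij : i = j by apply: (bs_sep blocks xi yj); rewrite exy orbT.
rewrite -{j}Eij in yj; rewrite !(fE i) //.
have := bs_edge blocks xi yj exy.
have := bs_edge blocks yj xi; rewrite e_sym => /(_ exy).
have [lt|lt|E] := ltngtP (idx i x) (idx i y).
- by move=> _; apply: (cs_edge (c_copies _) _ lt).
- by move=> + _; rewrite a_sym; apply: (cs_edge (c_copies _) _ lt).
- have Exy := bs_idx blocks xi yj (val_inj E).
  by rewrite Exy e_irr in exy.
Qed.

(** Induction on the number k of layers: all but the layer L, peeled off first,
are embedded outside R k, ..., R k0, so that R k is still free when the turn of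
L comes. There is enough room for L, because the 2 m vertices of W are not
embedded yet and outnumber the reserved vertices by at least t. *)
Lemma embed_layers f0 k (S : {set V}) : k <= k0 ->
    partial_embedding e a f0 X ->
    {in X, forall x i, i <= k0 -> f0 x \notin R i} ->
    [disjoint S & W :|: X] -> #|S| * M.-1 ^ k < M ^ k ->
  exists f, [/\ partial_embedding e a f (X :|: S), {in X, f =1 f0} &
    {in X :|: S, forall x i, k <= i <= k0 -> f x \notin R i}].
Proof.
elim: k S => [|k IHk] S lek f0_emb f0R dS leS.
  have S0 : S = set0 by apply/eqP; rewrite -cards_eq0; move: leS; lia.
  by exists f0; rewrite S0 setU0; split=> // x xX i /andP[_]; apply: f0R.
have [L [LS spr low leL]] := spread_layer e_sym deg_le (bs_low blocks dS).
have MS : #|S :\: L| * M <= #|S| * M.-1.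
  rewrite cardsD (setIidPr LS); have := subset_leq_card LS.
  have := M_gt0; rewrite -/M in leL; nia.
have [||f [f_emb fE fR]] := IHk (S :\: L) (ltnW lek) f0_emb f0R.
- exact: disjointWl (subsetDl _ _) dS.
- rewrite -(ltn_pmul2r M_gt0); apply: leq_ltn_trans (_ : #|S| * M.-1 ^ k.+1 < _).
    by rewrite mulnAC expnS mulnA leq_mul2r MS orbT.
  by rewrite -expnSr.
set D := X :|: S :\: L in f_emb fR.
have DL : D :|: L = X :|: S by rewrite -setUA [_ :\: _ :|: _]setUC -{1}(setIidPr LS) setID.
have dLD : [disjoint L & D].
  rewrite -setI_eq0; apply/eqP/setP=> x; rewrite !inE; apply/negP.
  case/andP=> xL; rewrite xL orbF => xX.
  by have := disjointFr dS (subsetP LS _ xL); rewrite inE xX orbT.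
pose Y := ~: (f @: D :|: \bigcup_(i < k0.+1 | k < i) R i).
have RY : R k \subset Y.
  apply/subsetP=> u uR; rewrite !inE negb_or; apply/andP; split.
    apply/negP=> /imsetP[x xD ux]; have := fR x xD k; rewrite leqnn (ltnW lek) -ux uR.
    by move/(_ isT).
  apply/negP=> /bigcupP[i ltki ui].
  have := disjointFr (R_disj (ltnW lek) (ltn_ord i : i <= k0) _) uR.
  by rewrite ui neq_ltn ltki => /(_ isT).
have leY : #|L| + t <= #|Y|.
  have cU : #|f @: D :|: \bigcup_(i < k0.+1 | k < i) R i| <= #|D| + \sum_(i < k0.+1) #|R i|.
    apply: leq_trans (leq_card_setU _ _) _; apply: leq_add; first exact: leq_imset_card.
    rewrite [leqRHS](bigID (fun i : 'I__ => k < i)) /=; apply: leq_trans (leq_addr _ _).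
    elim/big_rec2: _ => [|i n B _ le]; first by rewrite cards0.
    by apply: leq_trans (leq_card_setU _ _) _; rewrite leq_add2l.
  have cV : #|D| + #|L| + #|W| <= #|V|.
    have cDL : #|D :|: L| = #|D| + #|L|.
      by rewrite cardsU disjoint_setI0 ?cards0 ?subn0 // disjoint_sym.
    have dW : [disjoint D :|: L & W].
      rewrite DL -setI_eq0 setIUl setU_eq0 !setI_eq0 [[disjoint X & W]]disjoint_sym.
      by rewrite W_X_disjoint (disjointWr _ dS) // subsetUl.
    have := max_card (mem ((D :|: L) :|: W)).
    by rewrite cardsU disjoint_setI0 // cards0 subn0 cDL.
  rewrite /Y [#|~: _|]cardsCs setCK card_UV; rewrite card_W in cV; lia.
have [x||g [g_emb gE gY]] := extend_layer e_sym e_irr a_sym joined f_emb dLD spr _ _ RY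
    (R_expands (ltnW lek)) leY.
- move/low; apply: leq_trans; apply/subset_leq_card/setIS.
  by rewrite /D setUS // subsetDl.
- by rewrite disjoint_sym disjoints_subset /Y setCK subsetUl.
exists g; rewrite -DL; split=> //.
  by move=> x xX; rewrite gE ?fE // inE xX.
move=> x; rewrite inE => /orP[xD|xL] i /andP[ki ik].
  by rewrite gE // fR // ik (ltnW ki).
have := gY x xL; rewrite !inE negb_or => /andP[_]; apply: contra => xR.
by apply/bigcupP; exists (Ordinal (ik : i < k0.+1)).
Qed.
(** The final perfect matching of W with the set Y of unused vertices. A subset A
of W with at most t vertices satisfies Hall's condition inside R k0. For a
larger A, the set B of vertices of Y that A does not see has fewer than t
vertices. At least half of B avoids one of the zones Z b, so that at least #|B|
of the vertices w (b, j) are admissible for some vertex of B. None of them is in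
A, whence #|A| + #|B| <= #|W| = #|Y|. *)
Lemma embed_all : exists f : V -> U,
  injective f /\ forall x y, e x y -> a (f x) (f y).
Proof.
have [f0 [f0_emb f0T f0Z]] := embed_blocks.
pose D := ~: W; pose S := D :\: X.
have DE : X :|: S = D.
  rewrite /S -[in RHS](setID D X) (setIidPr _) // -disjoints_subset disjoint_sym.
  exact: W_X_disjoint.
have DW : D :|: W = setT by rewrite setUC setUCr.
have [|||f [f_emb fE fR]] := embed_layers (leqnn k0) f0_emb _ (_ : [disjoint S & _]).
- by move=> x /f0Z[b xZ] i lei; rewrite (disjointFl (RZ_disj b lei)).
- rewrite -setI_eq0; apply/eqP/setP=> x; rewrite !inE.
  by case: (x \in W); case: (x \in X).
- by apply: leq_ltn_trans layers_enough; rewrite leq_mul2r max_card orbT.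
rewrite DE in f_emb fR.
pose Y := ~: f @: D.
have nbrX i : nbr e (w i) \subset X.
  by apply: subset_trans (bs_nbr blocks i) _; apply: bigcup_sup.
have XD : X \subset D by rewrite -DE subsetUl.
have spr := bs_spread blocks.
have dY : [disjoint Y & f @: D] by rewrite disjoint_sym disjoints_subset setCK.
have RY : R k0 \subset Y.
  apply/subsetP=> u uR; rewrite inE; apply/negP=> /imsetP[x xD ux].
  by have := fR x xD k0; rewrite leqnn -ux uR => /(_ isT).
have low : {in W, forall x, #|nbr e x :&: D| <= 2 * d}.
  move=> x /imsetP[i _ ->]; apply: leq_trans (bs_deg blocks i).
  exact/subset_leq_card/subsetIl.
have cY : #|Y| = #|W|.
  rewrite /Y [#|~: _|]cardsCs setCK card_in_imset; last by have [] := f_emb.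
  by rewrite card_UV -(cardsCs W).
have [||g [[g_inj g_edge] _ _]] := extend_embedding e_sym e_irr a_sym f_emb _ spr dY.
- by rewrite disjoint_sym disjoints_subset.
- move=> A AW; have smallA := back_small f_emb spr low AW.
  have [leA|ltA] := leqP #|A| t.
    apply: leq_trans (expands_family (R_expands (leqnn k0)) leA smallA _) _.
      by move=> x _; apply: back_disjoint RY dY.
    apply/subset_leq_card/subsetP=> v; rewrite !inE => /andP[vZ ->].
    by have := subsetP RY v vZ; rewrite inE => ->.
  rewrite leqNgt; apply/negP=> ltS.
  set SA := seen _ _ _ _ in ltS; pose B := Y :\: SA.
  have SY : SA \subset Y by apply/subsetP=> v; rewrite inE => /andP[].
  have cB : #|B| = #|Y| - #|SA| by rewrite cardsD (setIidPr SY).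
  have cAW := subset_leq_card AW.
  have B_unseen i v : v \in B -> w i \in A -> ~~ sees a (c i.1 i.2 @: tau.2) v.
    rewrite !inE => /andP[+ vY] wA; rewrite vY /=; apply: contra => see.
    apply/existsP; exists (w i); rewrite wA; apply: subset_trans see.
    apply/subsetP=> u /imsetP[x]; rewrite inE => /andP[xN _] ->.
    have xT := subsetP (bs_nbr blocks i) x xN.
    by rewrite fE ?(subsetP (nbrX i)) // (f0T i x xT) imset_f // (bs_mark blocks xN).
  have [leB|ltB] := leqP t #|B|.
    have /set0Pn[v] := joined_family joined (ltnW ltA) leB smallA
      (fun x _ => back_disjoint e x (subsetDl _ _) dY).
    by rewrite !inE => /andP[/andP[/nandP[/negbTE->|/negbTE->]]].
  have [b leBb] : exists b, #|B| <= 2 * #|B :\: Z b|.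
    have := cardsID (Z true) B; have : #|B :&: Z true| <= #|B :\: Z false|.
      apply/subset_leq_card/subsetP=> v; rewrite !inE => /andP[-> vt].
      by rewrite (disjointFr Z_disj vt).
    move=> le1 le2; have [le3|gt3] := leqP #|B| (2 * #|B :\: Z true|).
      by exists true.
    by exists false; lia.
  have dB : [disjoint B :\: Z b & Z b].
    by rewrite -setI_eq0 setDE -setIA [~: _ :&: _]setIC setICr setI0.
  have leBt : #|B :\: Z b| <= t.
    by apply: leq_trans (ltnW ltB); apply/subset_leq_card/subsetDl.
  have := leq_trans leBb (cs_expand (c_copies b) dB leBt).
  set J := [set j | _] => leJ.
  have cJ : #|J| <= #|W :\: A|.
    rewrite -(card_in_imset (f := fun j => w (b, j))); last first.
      by move=> j j' _ _ /(bs_inj blocks)[].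
    apply/subset_leq_card/subsetP=> x /imsetP[j]; rewrite inE.
    case/existsP=> v /andP[/setDP[vB _] see] ->; rewrite inE imset_f // andbT.
    by apply/negP=> wA; have := B_unseen (b, j) v vB wA; rewrite see.
  have := leq_trans leJ cJ; rewrite cB cardsD (setIidPr AW) cY.
  by apply/negP; rewrite -ltnNge; apply: (ltn_sub2l _ ltS); apply: leq_trans ltS cAW.
rewrite DW in g_inj g_edge; exists g; split=> x y; first exact: g_inj.
exact: g_edge.
Qed.
End WithBlocks.

Lemma spanning_embedding : exists f : V -> U,
  injective f /\ forall x y, e x y -> a (f x) (f y).
Proof.
have cI : #|I| = 2 * m by rewrite card_prod card_bool card_ord.
have [||tau [w [T [idx bs]]]] :=
  block_structure_exists e_sym e_irr deg_le sparse (I := I).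
- by rewrite cI muln_gt0.
- by rewrite cI.
have [c Hc] := choice (fun b => copies b (bs_valid bs)).
exact: (embed_all bs Hc).
Qed.
End Spanning.

(** * Disjoint copies of a bounded graph *)

(** Only pairs inside Z are inspected, so that the edges leaving Z are independent
of this property. *)
Definition is_copies (U : finType) (a : rel U) K m (Z : {set U})
    (tau : block_type K) (c : {ffun 'I_m * 'I_K -> U}) : bool :=
  [&& injectiveb c, [forall x, c x \in Z] &
   [forall j, forall i : 'I_K, forall i' : 'I_K,
      (i < i') && block_edge tau i i' ==> a (c (j, i)) (c (j, i'))]].

Section Copies.
Variables (U : finType) (a : rel U) (u0 : U) (s t : nat).
Hypotheses (a_sym : symmetric a) (joined : well_joined a s t).

(** As long as t members of J are unmatched, t elements of B are unused, and
well_joined provides one more pair. *)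
Lemma greedy_matching (I : finType) (F : I -> {set U}) (J : {set I}) (B : {set U}) :
    small_family s F J -> {in J, forall j, [disjoint F j & B]} -> #|J| <= #|B| ->
  exists (J' : {set I}) (g : I -> U), [/\ J' \subset J, #|J| <= #|J'| + t,
    {in J' &, injective g} & {in J', forall j, g j \in B /\ sees a (F j) (g j)}].
Proof.
move=> /small_familyP[le dis] FB leJB.
suff H n : n <= #|J| - t -> exists (J' : {set I}) (g : I -> U),
    [/\ J' \subset J, #|J'| = n, {in J' &, injective g} &
        {in J', forall j, g j \in B /\ sees a (F j) (g j)}].
  have [J' [g [sub cJ g_inj gP]]] := H _ (leqnn _).
  by exists J', g; split=> //; rewrite cJ; lia.
elim: n => [|n IHn] len.
  by exists set0, (fun=> u0); split=> [||x y|x]; rewrite ?sub0set ?cards0 ?inE.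
have [J' [g [sub cJ g_inj gP]]] := IHn (ltnW len).
have leJ : t <= #|J :\: J'| by rewrite cardsD (setIidPr sub) cJ; lia.
have gB : g @: J' \subset B by apply/subsetP=> u /imsetP[j /gP[? _] ->].
have leB : t <= #|B :\: g @: J'|.
  by rewrite cardsD (setIidPr gB) card_in_imset // cJ; lia.
have /set0Pn[v] : seen a F (J :\: J') (B :\: g @: J') != set0.
  apply: joined_family joined leJ leB _ _.
    apply/small_familyP; split=> [j /setDP[jJ _]|j k /setDP[jJ _] /setDP[kJ _]].
      exact: le.
    exact: dis.
  by move=> j /setDP[jJ _]; apply: disjointWr (subsetDl _ _) (FB j jJ).
rewrite inE => /andP[/setDP[vB vg] /existsP[j /andP[/setDP[jJ jJ'] see]]].
exists (j |: J'), (fun k => if k == j then v else g k).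
have gv k : k \in J' -> g k != v.
  by move=> kJ; apply: contraNneq vg => <-; apply: imset_f.
split.
- by rewrite subUset sub1set jJ.
- by rewrite cardsU1 jJ' cJ.
- move=> k k'; rewrite !inE; case: eqP => [->|_] /=; case: eqP => [->|_] //=.
  + by move=> _ /gv/eqP H E; case: H.
  + by move=> /gv/eqP H _ E; case: H.
  + exact: g_inj.
- by move=> k; rewrite !inE; case: eqP => [->|_] //= /gP.
Qed.

Variables (K m : nat) (tau : block_type K) (P : 'I_K -> {set U}).
Hypothesis tau_valid : valid_type s tau.
Hypothesis P_disj : forall i i', i != i' -> [disjoint P i & P i'].
Hypothesis P_big : forall i, m + K * t <= #|P i|.

Let N := m + K * t.

(** The vertices number l of all the copies are found simultaneously inside P l,
by greedy_matching; each such step spoils at most t of the copies. *)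
Lemma partial_copies l : l <= K -> exists (c : 'I_N -> 'I_K -> U) (J : {set 'I_N}),
  [/\ N <= #|J| + l * t,
      {in J, forall j (i : 'I_K), i < l -> c j i \in P i},
      {in J &, forall j j' (i : 'I_K), i < l -> c j i = c j' i -> j = j'} &
      {in J, forall j (i i' : 'I_K), i < i' < l -> block_edge tau i i' ->
         a (c j i) (c j i')}].
Proof.
elim: l => [_|l IHl ltlK].
  exists (fun _ _ => u0), setT; split=> // [|j _ i i']; last by rewrite ltn0 andbF.
  by rewrite cardsT card_ord addn0.
have [c [J [cJ cP c_inj c_edge]]] := IHl (ltnW ltlK).
pose o := Ordinal ltlK.
pose F j := [set c j i | i in [set i : 'I_K | (i < l) && block_edge tau i o]].
have PE i i' u : u \in P i -> u \in P i' -> i = i'.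
  move=> ui ui'; apply/eqP; apply: contraTT ui' => /P_disj dis.
  by rewrite (disjointFr dis ui).
have [|||J' [g [sub cJ' g_inj gP]]] := @greedy_matching _ F J (P o).
- apply/small_familyP; split=> [j _|j j' jJ j'J jj'].
    apply: leq_trans (leq_imset_card _ _) _.
    by case/andP: tau_valid => _ /forallP/(_ o).
  rewrite -setI_eq0; apply/eqP/setP=> u; rewrite !inE; apply/negP.
  case/andP=> /imsetP[i + ->] /imsetP[i']; rewrite !inE => /andP[il _] /andP[i'l _] E.
  have Ei : i = i' by apply: PE (cP _ jJ _ il) _; rewrite E cP.
  by rewrite -Ei in E; case/eqP: jj'; apply: c_inj E.
- move=> j jJ; rewrite -setI_eq0; apply/eqP/setP=> u; rewrite !inE; apply/negP.
  case/andP=> /imsetP[i + ->] ; rewrite inE => /andP[il _] /(PE _ _ _ (cP _ jJ _ il)) E.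
  by rewrite E /= ltnn in il.
- by apply: leq_trans (P_big o); apply: leq_trans (max_card _) _; rewrite card_ord.
have subJ := subsetP sub.
have below (i : 'I_K) : i < l.+1 -> i <> o -> i < l.
  rewrite ltnS leq_eqVlt => /orP[/eqP il ne|//]; by case: ne; apply: val_inj.
exists (fun j i => if i == o then g j else c j i), J'; split.
- by apply: leq_trans cJ _; rewrite mulSn addnA leq_add2r.
- move=> j jJ i il; case: eqP => [->|ne]; first by have [] := gP j jJ.
  exact: (cP _ (subJ _ jJ) _ (below _ il ne)).
- move=> j j' jJ j'J i il; case: eqP => [_|ne]; first exact: g_inj.
  by apply: c_inj; [exact: subJ|exact: subJ|exact: below].
- move=> j jJ i i' /andP[ii']; move=> i'l E.
  have io : i == o = false by apply/negP=> /eqP iE; move: ii'; rewrite iE /=; lia.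
  rewrite io; case: eqP => [i'o|ne].
    have [_ /subsetP/(_ (c j i))] := gP j jJ; rewrite inE a_sym; apply.
    by apply: imset_f; rewrite inE -i'o E; rewrite i'o /= in ii'; rewrite ii'.
  apply: c_edge => //; first exact: subJ.
  by rewrite ii' below.
Qed.

Lemma copies_exist : exists c, is_copies a (\bigcup_i P i) tau (c : {ffun 'I_m * 'I_K -> U}).
Proof.
have [c [J [cJ cP c_inj c_edge]]] := partial_copies (leqnn K).
have leJ : m <= #|J| by move: cJ; rewrite leq_add2r.
pose h (j : 'I_m) := enum_val (widen_ord leJ j).
have hJ j : h j \in J by apply: enum_valP.
exists [ffun x : 'I_m * 'I_K => c (h x.1) x.2]; apply/and3P; split.
- apply/injectiveP=> -[j i] [j' i']; rewrite !ffunE /= => E.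
  have Ei : i = i'.
    apply/eqP; apply: contraT => /P_disj/disjointFr/(_ (cP _ (hJ j) i (ltn_ord i))).
    by rewrite E cP.
  rewrite -Ei in E *; congr (_, _).
  have /enum_val_inj/(congr1 val)/= := c_inj _ _ (hJ j) (hJ j') i (ltn_ord i) E.
  exact: val_inj.
- apply/forallP=> -[j i]; rewrite ffunE /=; apply/bigcupP; exists i => //.
  exact: cP.
- apply/forallP=> j; apply/forallP=> i; apply/forallP=> i'; apply/implyP.
  by rewrite !ffunE /= => /andP[ii' E]; apply: c_edge; rewrite // ii' /=.
Qed.
End Copies.

Import Order.TTheory GRing.Theory Num.Theory.
Local Open Scope ring_scope.

(** * The binomial random graph *)

Section Gnp.
Variables (R : realType) (n : nat) (p : R).
Hypothesis p01 : 0 <= p <= 1.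
Local Notation graph := (sgraph 'I_n).

Definition Pr (A : pred graph) : R := \sum_(G | A G) gnp_mass p G.

Lemma edge_card (G : graph) e : e \in edges G -> #|e| == 2%N.
Proof. by move=> eG; have /forall_inP := edges_card2 G; apply. Qed.

(** Distributivity: expanding the product on the right amounts to deciding for
each pair whether it is an edge. *)
Lemma sum_graphs (F F' : {set 'I_n} -> R) :
  \sum_(G : graph) \prod_(e : {set 'I_n} | #|e| == 2%N)
     (if e \in edges G then F e else F' e) =
  \prod_(e : {set 'I_n} | #|e| == 2%N) (F e + F' e).
Proof.
pose F1 (e : {set 'I_n}) := if #|e| == 2%N then F e else 0.
pose F2 (e : {set 'I_n}) := if #|e| == 2%N then F' e else 1.
transitivity (\prod_e (F1 e + F2 e)); last first.
  rewrite [RHS]big_mkcond; apply: eq_bigr => e _.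
  by rewrite /F1 /F2; case: ifP => //; rewrite add0r.
rewrite bigA_distr.
rewrite (bigID (fun J : {set {set 'I_n}} => [forall e in J, #|e| == 2%N])) /=.
rewrite [X in _ = _ + X]big1 ?addr0; last first.
  move=> J /forall_inPn[e eJ ne]; apply/eqP/prodf_eq0; exists e => //.
  by rewrite eJ /F1 (negPf ne).
rewrite (reindex_omap (fun G : graph => edges G) insub); last first.
  by move=> J HJ; rewrite insubT.
apply: eq_big => [G|G _].
  by rewrite edges_card2 valK eqxx.
rewrite big_mkcond; apply: eq_bigr => e _ /=.
rewrite /F1 /F2; case: (boolP (_ == _)) => // ne.
by case: ifP => // /edge_card; rewrite (negPf ne).
Qed.

Lemma mass_ge0 (G : graph) : 0 <= gnp_mass p G.
Proof.
case/andP: p01 => p0 p1; apply: prodr_ge0 => e _.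
by case: ifP; rewrite ?subr_ge0.
Qed.

Lemma sum_mass : \sum_(G : graph) gnp_mass p G = 1.
Proof.
rewrite sum_graphs big1 // => e _; by rewrite addrC subrK.
Qed.

Lemma Pr_ge0 A : 0 <= Pr A.
Proof. by apply: sumr_ge0 => G _; apply: mass_ge0. Qed.

Lemma Pr_mono (A B : pred graph) : (forall G, A G -> B G) -> Pr A <= Pr B.
Proof.
move=> AB; rewrite /Pr big_mkcond [leRHS]big_mkcond; apply: ler_sum => G _.
by case: ifP => [/AB->//|_]; case: ifP => // _; apply: mass_ge0.
Qed.

Lemma eq_Pr (A B : pred graph) : A =1 B -> Pr A = Pr B.
Proof. by move=> AB; apply: eq_bigl. Qed.

Lemma PrC (A : pred graph) : Pr (predC A) = 1 - Pr A.
Proof. by rewrite /Pr -sum_mass [X in _ = X - _](bigID A) /= addrAC subrr add0r. Qed.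

Lemma Pr_exists (T : finType) (S : {set T}) (A : T -> pred graph) :
  Pr (fun G => [exists x in S, A x G]) <= \sum_(x in S) Pr (A x).
Proof.
rewrite /Pr (exchange_big_dep predT) //= big_mkcond; apply: ler_sum => G _.
case: ifP => [/exists_inP[x xS AG]|_]; last first.
  by apply: sumr_ge0 => x _; apply: mass_ge0.
rewrite (bigD1 x) ?xS //= lerDl; apply: sumr_ge0 => y _; exact: mass_ge0.
Qed.

Lemma Pr_exists_le (T : finType) (S : {set T}) (A : T -> pred graph) eps :
  (forall x, x \in S -> Pr (A x) <= eps) ->
  Pr (fun G => [exists x in S, A x G]) <= #|S|%:R * eps.
Proof.
move=> le; apply: le_trans (Pr_exists _ _) _.
by rewrite mulr_natl -sumr_const; apply: ler_sum.
Qed.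

Lemma Pr_or (A B : pred graph) : Pr (predU A B) <= Pr A + Pr B.
Proof.
rewrite /Pr big_mkcond [X in _ <= X + _]big_mkcond [X in _ <= _ + X]big_mkcond.
rewrite -big_split; apply: ler_sum => G _ /=.
by case: (A G) => /=; case: (B G); rewrite ?addr0 ?add0r ?lerDl ?mass_ge0.
Qed.

(** The instance of sum_graphs in which the absence of an edge of D has
weight 0. *)
Lemma Pr_edges (D : {set {set 'I_n}}) : {in D, forall e : {set 'I_n}, #|e| == 2%N} ->
  Pr (fun G => D \subset edges G) = p ^+ #|D|.
Proof.
move=> D2.
transitivity (\sum_(G : graph) \prod_(e : {set 'I_n} | #|e| == 2%N)
    (if e \in edges G then p else if e \in D then 0 else 1 - p)).
  rewrite /Pr big_mkcond; apply: eq_bigr => G _; case: ifP => [/subsetP sub|].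
    apply: eq_bigr => e _; case: ifPn => // ne; case: ifP => // /sub.
    by rewrite (negPf ne).
  move/negbT/subsetPn => [e eD ne]; apply/esym/eqP/prodf_eq0; exists e.
    exact: D2.
  by rewrite (negPf ne) eD.
rewrite sum_graphs (bigID (mem D)) /= [X in _ * X]big1 ?mulr1; last first.
  by move=> e /andP[_ ne]; rewrite (negPf ne) addrC subrK.
rewrite -prodr_const; apply: eq_big => [e|e /andP[_ eD]].
  by apply: andb_idl; apply: D2.
by rewrite eD addr0.
Qed.

Definition depends_on (D : {set {set 'I_n}}) (A : pred graph) :=
  forall G G', edges G :&: D = edges G' :&: D -> A G = A G'.

Lemma mix_card2 (D : {set {set 'I_n}}) (G G' : graph) :
  [forall e in (edges G :&: D) :|: (edges G' :\: D), #|e| == 2%N].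
Proof.
apply/forall_inP=> e; rewrite !inE => /orP[/andP[/edge_card//]|].
by case/andP=> _ /edge_card.
Qed.

Definition mix D (G G' : graph) := SGraph (mix_card2 D G G').

Lemma mixK D (G G' : graph) : mix D (mix D G G') (mix D G' G) = G.
Proof.
apply: val_inj; apply/setP=> e /=; rewrite !inE.
by case: (e \in D); case: (e \in edges G); case: (e \in edges G').
Qed.

Lemma mass_mix D (G G' : graph) :
  gnp_mass p (mix D G G') * gnp_mass p (mix D G' G) = gnp_mass p G * gnp_mass p G'.
Proof.
rewrite /gnp_mass -!big_split; apply: eq_bigr => e _ /=; rewrite !inE.
case: (e \in D); case: (e \in edges G); case: (e \in edges G') => //=;
  by rewrite mulrC.
Qed.

(** Exchanging their edges outside D is a measure-preserving involution on pairs
(G, G') of independent graphs. It turns the event that A G and B G' hold into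
the event that A G and B G hold. *)
Lemma Pr_indep D (A B : pred graph) : depends_on D A -> depends_on (~: D) B ->
  Pr (predI A B) = Pr A * Pr B.
Proof.
move=> dA dB; rewrite /Pr big_distrlr /=.
pose sw (x : graph * graph) := (mix D x.1 x.2, mix D x.2 x.1).
have swK : involutive sw by case=> G G'; rewrite /sw /= !mixK.
rewrite pair_big /= (reindex_inj (inv_inj swK)) /=.
transitivity (\sum_(x : graph * graph | predI A B x.1)
    gnp_mass p x.1 * gnp_mass p x.2).
  transitivity (\sum_(x : graph * graph | predI A B x.1 && predT x.2)
      gnp_mass p x.1 * gnp_mass p x.2); last first.
    by apply: eq_bigl => x; rewrite andbT.
  rewrite -(pair_big (predI A B) predT (fun G G' => gnp_mass p G * gnp_mass p G')) /=.
  by apply: eq_bigr => G _; rewrite -big_distrr /= sum_mass mulr1.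
apply: eq_big => [[G G']|[G G'] _] /=; last by rewrite mass_mix.
congr (_ && _); [apply: dA|apply: dB]; apply/setP=> e /=; rewrite !inE.
  by case: (e \in D); case: (e \in edges G); case: (e \in edges G').
by case: (e \in D); case: (e \in edges G); case: (e \in edges G').
Qed.

Lemma Pr_indep_seq (J : eqType) (s : seq J) (D : J -> {set {set 'I_n}})
    (A : J -> pred graph) :
  uniq s -> (forall j, j \in s -> depends_on (D j) (A j)) ->
  {in s &, forall i j, i != j -> [disjoint D i & D j]} ->
  Pr (fun G => all (fun j => A j G) s) = \prod_(j <- s) Pr (A j).
Proof.
elim: s => [|j s IHs] /= => [_ _ _|/andP[js us] dep dis].
  rewrite big_nil -sum_mass; exact: eq_bigl.
rewrite big_cons -IHs //; first last.
- by move=> i k ins ks; apply: dis; rewrite inE ?ins ?ks orbT.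
- by move=> i ins; apply: dep; rewrite inE ins orbT.
rewrite -(@Pr_indep (D j)) //; first by apply: dep; rewrite mem_head.
move=> G G' E; apply: eq_in_all => i ins; apply: (dep i).
  by rewrite inE ins orbT.
have sub : D i \subset ~: D j.
  rewrite -disjoints_subset; apply: dis; rewrite ?inE ?eqxx ?ins ?orbT //.
  by apply: contraNneq js => <-.
by rewrite -(setIidPr sub) !setIA E.
Qed.

Lemma adj_sym (G : graph) : symmetric (adj G).
Proof. by move=> x y; rewrite /adj setUC. Qed.

Definition star (X : {set 'I_n}) v := [set [set v; x]%SET | x in X].

Lemma star_card (X : {set 'I_n}) v : v \notin X ->
  #|star X v| = #|X| /\ {in star X v, forall e : {set 'I_n}, #|e| == 2%N}.
Proof.
move=> vX; split; last first.
  move=> e /imsetP[x xX ->]; rewrite cards2 (_ : v != x) //.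
  by apply: contraNneq vX => ->.
apply: card_in_imset => x y xX yX /setP/(_ x); rewrite !inE eqxx orbT.
case: eqP => [xv|_ /esym/eqP//]; by rewrite -xv xX in vX.
Qed.

Lemma seesE (G : graph) X v : sees (adj G) X v = (star X v \subset edges G).
Proof.
apply/subsetP/subsetP=> [H e /imsetP[x /H]|H x xX].
  by rewrite inE => + ->.
by rewrite inE; apply: H; apply: imset_f.
Qed.

Lemma sees_depends X v (D : {set {set 'I_n}}) : star X v \subset D ->
  depends_on D (fun G => sees (adj G) X v).
Proof.
move=> sub G G' E; rewrite !seesE.
have ED (H : graph) : (star X v \subset edges H) = (star X v \subset edges H :&: D).
  by rewrite subsetI sub andbT.
by rewrite ED E -ED.
Qed.

(** Whether v sees F i depends on the edges between v and F i. Since B is disjoint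
from all the F i, these sets of edges are pairwise disjoint, and the events are
independent. *)
Lemma Pr_unseen (I : finType) (F : I -> {set 'I_n}) (A : {set I}) (B : {set 'I_n}) s :
  small_family s F A -> {in A, forall i, [disjoint F i & B]} ->
  Pr (fun G => seen (adj G) F A B == set0) <= (1 - p ^+ s) ^+ (#|A| * #|B|).
Proof.
move=> /small_familyP[small dis] FB.
case/andP: p01 => p0 p1.
have q1 k : 0 <= 1 - p ^+ k by rewrite subr_ge0 exprn_ile1.
pose P := enum (setX A B).
rewrite (eq_Pr (B := fun G => all (fun x => ~~ sees (adj G) (F x.1) x.2) P)); last first.
  move=> G; apply/eqP/allP=> [E [i v]|H].
    rewrite mem_enum inE /= => /andP[iA vB].
    by move/setP/(_ v): E; rewrite !inE vB /= => /negbT/exists_inPn/(_ i iA).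
  apply/setP=> v; rewrite !inE; apply/negP=> /andP[vB /existsP[i /andP[iA see]]].
  have := H (i, v); rewrite mem_enum inE /= iA vB see => /(_ isT).
  by [].
have inP i v : (i, v) \in P -> i \in A /\ v \in B.
  by rewrite mem_enum inE => /andP[].
have notF i v : i \in A -> v \in B -> v \notin F i.
  by move=> iA vB; rewrite (disjointFl (FB i iA)).
rewrite (@Pr_indep_seq _ P (fun x => star (F x.1) x.2)
    (fun x G => ~~ sees (adj G) (F x.1) x.2)).
- rewrite big_enum /= -cardsX -prodr_const; apply: ler_prod => -[i v] /setXP[/= iA vB].
  rewrite Pr_ge0 (PrC (fun G => sees (adj G) (F i) v)) lerB //.
  rewrite (eq_Pr (B := fun G => star (F i) v \subset edges G)); last first.
    by move=> G; rewrite seesE.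
  have [cS S2] := star_card (notF i v iA vB).
  by rewrite Pr_edges // cS; apply: ler_wiXn2l => //; apply: small.
- exact: enum_uniq.
- by move=> x _ G G' E; rewrite (sees_depends (subxx _) E).
- move=> [i v] [j u] /inP[iA vB] /inP[jA uB] ne /=.
  rewrite -setI_eq0; apply/eqP/setP=> e; rewrite !inE; apply/negP.
  case/andP=> /imsetP[x xi ->] /imsetP[y yj] E.
  have [Ev Ex] : v = u /\ x = y.
    have /setP/(_ v) := E; rewrite !inE eqxx /= => /esym/orP[/eqP vu|/eqP vy].
      split=> //; have /setP/(_ x) := E; rewrite !inE eqxx orbT => /esym/orP[/eqP xu|/eqP//].
      by have := notF i u iA uB; rewrite -xu xi.
    by have := notF j v jA vB; rewrite vy yj.
  case/eqP: ne; congr (_, _) => //; apply/eqP; apply: contraT => ij.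
  by have := disjointFr (dis i j iA jA ij) xi; rewrite Ex yj.
Qed.
End Gnp.

(** * Union bounds for the expansion properties *)

(** A set of at most s elements is the set of proper values of a map from 'I_s to
option T. *)
Lemma card_small_sets (T : finType) s :
  (#|[set S : {set T} | #|S| <= s]| <= #|T|.+1 ^ s)%N.
Proof.
pose g (c : {ffun 'I_s -> option T}) := [set x | [exists i, c i == Some x]].
have -> : (#|T|.+1 ^ s = #|{ffun 'I_s -> option T}|)%N.
  by rewrite card_ffun card_option card_ord.
rewrite -cardsT; apply: leq_trans (leq_imset_card g _).
apply/subset_leq_card/subsetP=> S; rewrite inE => leS; apply/imsetP.
exists [ffun i : 'I_s => nth None (map Some (enum S)) i] => //.
apply/setP=> x; rewrite inE; apply/idP/existsP=> [xS|[i]].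
  have ltx : (index x (enum S) < #|S|)%N by rewrite cardE index_mem mem_enum.
  exists (Ordinal (leq_trans ltx leS)); rewrite ffunE /= (nth_map x) -?cardE //.
  by rewrite nth_index // mem_enum.
rewrite ffunE; have [lti|gei] := ltnP i (size (map Some (enum S))); last first.
  by rewrite nth_default.
move=> /eqP E; have := mem_nth None lti; rewrite E => /mapP[y].
by rewrite mem_enum => yS [->].
Qed.

Section Good.
Variables (R : realType) (n : nat) (p : R) (s t : nat).
Hypothesis p01 : 0 <= p <= 1.
Local Notation graph := (sgraph 'I_n).
Local Notation eta := ((n.+1%:R : R)^-1).
Hypothesis s_ge2 : (2 <= s)%N.
(* In the union bounds each member of a family brings in at most
   n.+1 ^ (s + 1) possibilities; the excess of s + 5 over s + 1 leaves room to
   sum over the sizes of the families. *)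
Hypothesis t_small : (1 - p ^+ s) ^+ t <= eta ^+ (s + 5).
Hypothesis t_le : (t <= n)%N.
Hypothesis t_gt0 : (0 < t)%N.

Let q_ge0 : 0 <= 1 - p ^+ s.
Proof. by case/andP: p01 => p0 p1; rewrite subr_ge0 exprn_ile1. Qed.

Let q_le1 : 1 - p ^+ s <= 1.
Proof. by case/andP: p01 => p0 p1; rewrite gerBl exprn_ge0. Qed.

Lemma eta_gt0 : 0 < eta.
Proof. by rewrite invr_gt0 ltr0n. Qed.

Lemma eta_le1 : eta <= 1.
Proof. by rewrite invf_le1 ?ltr0n // ler1n. Qed.

Lemma natr_eta c j k : (c <= n.+1 ^ j)%N -> c%:R * eta ^+ (j + k) <= eta ^+ k.
Proof.
move=> le; have etaX i : 0 <= eta ^+ i by rewrite exprn_ge0 ?(ltW eta_gt0).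
rewrite exprD mulrA ler_piMl // exprVn.
rewrite ler_pdivrMr ?exprn_gt0 ?ltr0n // mul1r -natrX ler_nat; exact: le.
Qed.

(** By the choice of t, a family with at least a * t pairs is unseen with
probability at most eta ^+ ((s + 5) * a). *)
Lemma union_unseen a j (I T : finType) (S : {set T})
    (F : T -> I -> {set 'I_n}) (A : T -> {set I}) (B : T -> {set 'I_n}) :
  (0 < a)%N -> (j <= s.+1)%N -> (#|S| <= n.+1 ^ (j * a))%N ->
  (forall x, x \in S -> [/\ small_family s (F x) (A x),
     {in A x, forall i, [disjoint F x i & B x]} & (a * t <= #|A x| * #|B x|)%N]) ->
  Pr p (fun G : graph => [exists x in S, seen (adj G) (F x) (A x) (B x) == set0])
     <= eta ^+ 4.
Proof.
move=> a0 js cS H.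
apply: le_trans (_ : #|S|%:R * eta ^+ (j * a + 4) <= _); last exact: natr_eta.
apply: (Pr_exists_le p01 (A := fun x G => seen (adj G) (F x) (A x) (B x) == set0)).
move=> x /H[small dis le].
apply: le_trans (Pr_unseen p01 small dis) _.
apply: le_trans (ler_wiXn2l q_ge0 q_le1 le) _.
rewrite mulnC exprM; apply: le_trans (_ : (eta ^+ (s + 5)) ^+ a <= _).
  by apply: lerXn2r; rewrite ?nnegrE ?exprn_ge0 // ltW // eta_gt0.
rewrite -exprM; apply: ler_wiXn2l; rewrite ?(ltW eta_gt0) ?eta_le1 //; nia.
Qed.

Lemma card_families a b (E : finType) :
  (#|E| <= n)%N ->
  (#|[set x : {ffun 'I_a -> {set 'I_n}} * {set E} |
      (x.1 \in ffun_on (mem [set S : {set 'I_n} | #|S| <= s])) &&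
      (#|x.2| <= b)]| <= n.+1 ^ (s * a + b))%N.
Proof.
move=> leE.
have := card_small_sets 'I_n s; have := card_small_sets E b.
rewrite card_ord => le2 le1.
rewrite (_ : [set x | _] = setX [set f in ffun_on (mem [set S : {set 'I_n} | #|S| <= s]%N)]
    [set S : {set E} | #|S| <= b]%N); last first.
  by apply/setP=> -[f S]; rewrite !inE.
rewrite cardsX expnD; apply: leq_mul.
  rewrite cardsE card_ffun_on card_ord expnM.
  by case: a => // a; rewrite leq_exp2r.
by apply: leq_trans le2 _; case: b => // b; rewrite leq_exp2r.
Qed.

(** If a family of size k sees only a set C of fewer than k <= t vertices of X,
then it sees nothing in X :\: C, which has at least t vertices. The union bound
is over the family and C. *)
Lemma Pr_not_expands (X : {set 'I_n}) : (2 * t <= #|X|)%N ->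
  Pr p (fun G : graph => ~~ `[< expands_into (adj G) s t X >]) <= eta ^+ 3.
Proof.
move=> bigX.
pose S a := [set x : {ffun 'I_a -> {set 'I_n}} * {set 'I_n} |
   [&& x.1 \in ffun_on (mem [set S : {set 'I_n} | #|S| <= s]%N), (#|x.2| <= a)%N,
       small_family s x.1 setT & [forall i, [disjoint x.1 i & X]]]].
pose bad a (G : graph) := [exists x in S a, seen (adj G) x.1 setT (X :\: x.2) == set0].
apply: le_trans (_ : Pr p (fun G : graph => [exists a in [set: 'I_t], bad a.+1 G]) <= _).
  apply: Pr_mono => // G /asboolPn H; apply: contra_notT H => /existsPn H.
  move=> k F lek small dis; rewrite leqNgt; apply/negP=> lt.
  have k0 : (0 < k)%N by apply: leq_ltn_trans lt.
  case: k k0 F lek small dis lt => // k _ F lek small dis lt.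
  have := H (Ordinal lek); rewrite inE /= => /negP; apply.
  have eF : [ffun i => F i] =1 F by move=> i; rewrite ffunE.
  have [/forall_inP le _] := andP small.
  apply/existsP; exists ([ffun i => F i], seen (adj G) F setT X); apply/andP; split.
    rewrite inE /= (ltnW lt); apply/and4P; split=> //.
    - by apply/ffun_onP=> i; rewrite inE ffunE le.
    - case/small_familyP: small => le' dis'.
      by apply/small_familyP; split=> [i _|i j _ _ ij]; rewrite !ffunE ?le' ?dis' ?inE.
    - by apply/forallP=> i; rewrite ffunE.
  apply/eqP/setP=> v; rewrite !inE; apply/negP=> /andP[/andP[+ vX] /existsP[i]].
  rewrite vX ffunE /= => /existsPn/(_ i); by rewrite inE /= => /negPf->.
apply: le_trans (Pr_exists_le p01 (eps := eta ^+ 4) _) _; last first.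
  by rewrite cardsT card_ord; apply: (@natr_eta t 1 3); rewrite expn1 (leq_trans t_le).
move=> a _; apply: (@union_unseen a.+1 s.+1) => //.
  apply: leq_trans (subset_leq_card _) _; last first.
    rewrite mulSn addnC; apply: (@card_families a.+1 a.+1 'I_n); by rewrite card_ord.
  by apply/subsetP=> x; rewrite !inE => /and3P[-> ->].
move=> x; rewrite inE => /and4P[_ lex small /forallP dis]; split=> //.
  by move=> i _; apply: disjointWr (subsetDl _ _) (dis i).
rewrite cardsT card_ord leq_mul2l /= cardsD.
have leI := leq_trans (subset_leq_card (subsetIr X x.2)) lex.
apply: leq_trans (leq_sub2l _ leI); have := ltn_ord a; lia.
Qed.

Lemma Pr_not_joined :
  Pr p (fun G : graph => ~~ `[< well_joined (adj G) s t >]) <= eta ^+ 4.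
Proof.
pose S := [set x : {ffun 'I_t -> {set 'I_n}} * {set 'I_n} |
   [&& x.1 \in ffun_on (mem [set S : {set 'I_n} | #|S| <= s]%N), (#|x.2| == t)%N,
       small_family s x.1 setT & [forall i, [disjoint x.1 i & x.2]]]].
apply: le_trans (_ : Pr p (fun G : graph =>
    [exists x in S, seen (adj G) x.1 setT x.2 == set0]) <= _).
  apply: Pr_mono => // G /asboolPn H; apply: contra_notT H => /existsPn H.
  move=> F B cB small dis; have := H ([ffun i => F i], B).
  rewrite !inE /= cB eqxx /= => /nandP[|].
    move=> /negP; case; apply/and3P; split.
    - case/andP: small => /forall_inP le _.
      by apply/ffun_onP=> i; rewrite inE ffunE le.
    - case/small_familyP: small => le' dis'.
      by apply/small_familyP; split=> [i _|i j _ _ ij]; rewrite !ffunE ?le' ?dis' ?inE.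
    - by apply/forallP=> i; rewrite ffunE.
  apply: contraNneq => seen0; apply/eqP/setP=> v; rewrite !inE.
  have := in_set0 v; rewrite -{1}seen0 inE; apply: contraFF => /andP[-> /=].
  by case/existsP=> i; rewrite ffunE inE /= => see; apply/existsP; exists i; rewrite inE.
apply: (@union_unseen t s.+1) => //.
  apply: leq_trans (subset_leq_card _) _; last first.
    rewrite mulSn addnC; apply: (@card_families t t 'I_n); by rewrite card_ord.
  by apply/subsetP=> x; rewrite !inE => /and3P[-> /eqP->]; rewrite leqnn.
move=> x; rewrite inE => /and4P[_ /eqP cx small /forallP dis]; split=> //.
by rewrite cardsT card_ord cx.
Qed.

(** The choice of c is revealed by the edges in D, and bad c concerns the other
edges: its probability is the same conditionally on c being chosen. *)
Lemma Pr_chosen (C : finType) (D : {set {set 'I_n}}) (Q bad : C -> pred graph) eps :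
  (forall c, depends_on D (Q c)) -> (forall c, depends_on (~: D) (bad c)) ->
  (forall c G, Q c G -> Pr p (bad c) <= eps) -> 0 <= eps ->
  Pr p (fun G => if [pick c | Q c G] is Some c then bad c G else false) <= eps.
Proof.
move=> dQ dbad le eps0.
pose ch c (G : graph) := [pick c | Q c G] == Some c.
rewrite (eq_Pr p (B := fun G => [exists c in setT, predI (ch c) (bad c) G])); last first.
  move=> G; apply/idP/existsP=> [|[c]].
    case E: [pick c | Q c G] => [c|//] bc; exists c.
    by rewrite inE /= bc /ch E eqxx.
  by rewrite inE /= => /andP[/eqP-> ->].
apply: le_trans (Pr_exists p01 _ _) _.
have pch c : Pr p (predI (ch c) (bad c)) <= Pr p (ch c) * eps.
  have dch : depends_on D (ch c).
    by move=> G G' E; rewrite /ch (eq_pick (Q := fun c => Q c G')) // => c'; apply: dQ.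
  rewrite (Pr_indep p dch) //.
  have [/existsP[G]|/existsPn no] := boolP [exists G, ch c G].
    rewrite /ch; case: pickP => // c' Qc' /eqP[Ec]; rewrite Ec in Qc'.
    apply: ler_wpM2l (le _ _ Qc'); exact: Pr_ge0.
  have -> : Pr p (ch c) = 0 by apply: big1 => G cG; have := no G; rewrite cG.
  by rewrite !mul0r.
apply: le_trans (ler_sum _ (fun c _ => pch c)) _.
rewrite -mulr_suml ler_piMl //.
rewrite -(sum_mass n p) /Pr (exchange_big_dep predT) //=; apply: ler_sum => G _.
rewrite /ch; case: pickP => [c _|_]; last by rewrite big_pred0 ?mass_ge0 // => c; rewrite inE.
by rewrite (big_pred1 c) // => c'; rewrite inE /= eq_sym.
Qed.

Variables (K m : nat) (tau : block_type K) (Z : {set 'I_n}).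
Hypothesis m_big : (3 * t <= m)%N.
Hypothesis m_le : (m <= n)%N.
Hypothesis tau_valid : valid_type s tau.

Definition unexpanding (c : {ffun 'I_m * 'I_K -> 'I_n}) (G : graph) :=
  [exists A : {set 'I_n}, [&& [disjoint A & Z], (#|A| <= t)%N &
    (#|[set j | [exists v in A, sees (adj G) ((fun i => c (j, i)) @: tau.2) v]]| < 2 * #|A|)%N]].

(** If the set J of copies whose marks are seen from A is smaller than 2 #|A|, then
no copy outside J is seen from A. The union bound is over A and J; since
m >= 3 t, at least t copies are outside J. *)
Lemma Pr_unexpanding c (G0 : graph) : is_copies (adj G0) Z tau c ->
  Pr p (unexpanding c) <= eta ^+ 3.
Proof.
case/and3P=> /injectiveP c_inj /forallP cZ _.
pose F j := (fun i => c (j, i)) @: tau.2.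
have FZ j : F j \subset Z by apply/subsetP=> v /imsetP[i _ ->].
pose S a := [set x : {set 'I_n} * {set 'I_m} |
   [&& #|x.1| == a, (#|x.2| <= 2 * a)%N & [disjoint x.1 & Z]]].
pose bad a (G : graph) := [exists x in S a, seen (adj G) F (~: x.2) x.1 == set0].
apply: le_trans (_ : Pr p (fun G : graph => [exists a in [set: 'I_t], bad a.+1 G]) <= _).
  apply: Pr_mono => // G /existsP[A /and3P[AZ leA]].
  set J := [set j | _] => ltJ.
  have A0 : (0 < #|A|)%N by move: ltJ; case: #|A|.
  have ltA : (#|A|.-1 < t)%N by rewrite prednK.
  apply/existsP; exists (Ordinal ltA); rewrite inE /= prednK //.
  apply/existsP; exists (A, J); rewrite inE /= eqxx (ltnW ltJ) AZ /=.
  apply/eqP/setP=> v; rewrite !inE; apply/negP=> /andP[vA /existsP[j]].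
  rewrite !inE => /andP[/existsPn/(_ v)]; by rewrite vA /= => /negP.
apply: le_trans (Pr_exists_le p01 (eps := eta ^+ 4) _) _; last first.
  by rewrite cardsT card_ord; apply: (@natr_eta t 1 3); rewrite expn1 (leq_trans t_le).
move=> a _; apply: (@union_unseen a.+1 3) => //.
  apply: leq_trans (_ : #|setX [set A : {set 'I_n} | #|A| <= a.+1]
     [set J : {set 'I_m} | #|J| <= 2 * a.+1]| <= _)%N.
    apply/subset_leq_card/subsetP=> -[A J]; rewrite !inE /=.
    by case/and3P=> /eqP-> -> _; rewrite leqnn.
  rewrite cardsX (_ : 3 * a.+1 = a.+1 + 2 * a.+1)%N; last by lia.
  have := card_small_sets 'I_n a.+1; have := card_small_sets 'I_m (2 * a.+1).
  rewrite !card_ord => le2 le1; rewrite expnD; apply: leq_mul => //.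
  by apply: leq_trans le2 _; rewrite leq_exp2r ?muln_gt0.
move=> [A J]; rewrite inE /= => /and3P[/eqP cA cJ AZ]; split.
- apply/small_familyP; split=> [j _|j j' _ _ jj'].
    by apply: leq_trans (leq_imset_card _ _) _; case/andP: tau_valid.
  rewrite -setI_eq0; apply/eqP/setP=> v; rewrite !inE; apply/negP.
  case/andP=> /imsetP[i _ ->] /imsetP[i' _] /c_inj[E _].
  by rewrite E eqxx in jj'.
- by move=> j _; apply: disjointWl (FZ j) _; rewrite disjoint_sym.
- rewrite cA mulnC leq_mul2r /= cardsCs setCK card_ord.
  by apply: leq_trans (leq_sub2l _ cJ); have := ltn_ord a; lia.
Qed.

Lemma is_copies_depends (c : {ffun 'I_m * 'I_K -> 'I_n}) :
  depends_on [set e : {set 'I_n} | e \subset Z]%SET (fun G => is_copies (adj G) Z tau c).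
Proof.
move=> G G' E; rewrite /is_copies; congr (_ && _).
case: (boolP [forall x, c x \in Z]) => //= /forallP cZ.
apply: eq_forallb => j; apply: eq_forallb => i; apply: eq_forallb => i'.
congr (_ ==> _); have /setP/(_ [set c (j, i); c (j, i')]) := E.
by rewrite !inE subUset !sub1set !cZ !andbT.
Qed.

Lemma unexpanding_depends (c : {ffun 'I_m * 'I_K -> 'I_n}) :
  (forall x, c x \in Z) ->
  depends_on (~: [set e : {set 'I_n} | e \subset Z]%SET) (unexpanding c).
Proof.
move=> cZ G G' E; apply: eq_existsb => A; case: (boolP [disjoint A & Z]) => //= AZ.
congr (_ && (#|(_ : {set _})| < _)%N); apply/setP=> j; rewrite !inE.
apply: eq_existsb => v; case: (boolP (v \in A)) => //= vA.
apply: (@sees_depends _ _ _ (~: [set e : {set 'I_n} | e \subset Z]%SET)) => //.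
apply/subsetP=> e /imsetP[x _ ->]; rewrite !inE subUset sub1set.
by rewrite (disjointFr AZ vA).
Qed.

(** The copies are selected by their edges, which are inside Z; their expansion
concerns the edges that leave Z. *)
Lemma Pr_no_copy_system :
  Pr p (fun G : graph => [exists c : {ffun 'I_m * 'I_K -> 'I_n}, is_copies (adj G) Z tau c] &&
     ~~ `[< exists c, @copy_system _ (adj G) K m t Z tau c >]) <= eta ^+ 3.
Proof.
pose bad (c : {ffun 'I_m * 'I_K -> 'I_n}) (G : graph) := [forall x, c x \in Z] && unexpanding c G.
apply: le_trans (_ : Pr p (fun G : graph =>
    if [pick c : {ffun 'I_m * 'I_K -> 'I_n} | is_copies (adj G) Z tau c] is Some c then bad c G else false) <= _).
  apply: Pr_mono => // G /andP[/existsP[c0 c0P] /asboolPn H].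
  case: pickP => [c cP|/(_ c0)]; last by rewrite c0P.
  have /and3P[/injectiveP c_inj cZ /forallP c_edge] := cP.
  rewrite /bad cZ /=; apply: contra_notT H => /existsPn H.
  exists (fun j i => c (j, i)); split.
  - by move=> j j' i i' /c_inj[-> ->].
  - by move=> j i; apply: (forallP cZ).
  - move=> j i i' ii' E; have /forallP/(_ i)/forallP/(_ i')/implyP := c_edge j.
    by apply; rewrite ii'.
  - move=> A AZ leA; have := H A; by rewrite AZ leA /= -leqNgt.
apply: (@Pr_chosen _ [set e : {set 'I_n} | e \subset Z]%SET).
- exact: is_copies_depends.
- move=> c G G' E; rewrite /bad; case: (boolP [forall x, _]) => //= /forallP cZ.
  exact: unexpanding_depends.
- move=> c G cP; apply: le_trans (Pr_unexpanding cP); apply: Pr_mono => // G'.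
  by case/andP.
- by rewrite exprn_ge0 // ltW // eta_gt0.
Qed.
End Good.

(** * Universality for a fixed number of vertices *)

Section Reduction.
Local Open Scope nat_scope.

(** Each edge inside S is charged to its endpoint of higher rank. *)
Lemma ranked_sparse (V : finType) (e : rel V) (r : V -> nat) d :
  symmetric e -> (forall x y, e x y -> r x != r y) ->
  (forall x, #|[set y | e x y & r y < r x]| <= d) ->
  forall S, degsum e S S <= 2 * d * #|S|.
Proof.
move=> e_sym r_neq back_le S.
pose low x := \sum_(y in S) (e x y && (r y < r x)).
have -> : degsum e S S = 2 * \sum_(x in S) low x.
  rewrite degsumE mul2n -addnn [X in _ = _ + X]exchange_big -big_split /=.
  apply: eq_bigr => x _; rewrite -big_split; apply: eq_bigr => y _ /=.
  rewrite (e_sym y x); case exy: (e x y) => //=.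
  by have := r_neq x y exy; case: (ltngtP (r x) (r y)) => /=.
rewrite -mulnA leq_mul2l /= mulnC -sum_nat_const; apply: leq_sum => x _.
apply: leq_trans (back_le x); rewrite /low -sum1_card big_mkcond [leqRHS]big_mkcond /=.
by apply: leq_sum => y _; rewrite inE; case: (y \in S).
Qed.

Variables (n d Delta : nat) (V : finType) (H : sgraph V).
Hypothesis H_fam : bounded_degenerate n d Delta H.

(** Isolated vertices bring the number of vertices to exactly n. *)
Definition padded : finType := (V + 'I_(n - #|V|))%type.

Definition padded_adj : rel padded := fun x y =>
  if (x, y) is (inl u, inl v) then adj H u v else false.

Lemma adj_irr : irreflexive (adj H).
Proof.
move=> x; apply/negP; rewrite /adj setUid => xH.
by have /forall_inP/(_ _ xH) := edges_card2 H; rewrite cards1.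
Qed.

Lemma card_padded : #|padded| = n.
Proof. by case: H_fam => le _ _; rewrite card_sum card_ord subnKC. Qed.

Lemma padded_sym : symmetric padded_adj.
Proof. by move=> [x|x] [y|y] //=; rewrite /padded_adj /adj setUC. Qed.

Lemma padded_irr : irreflexive padded_adj.
Proof. by move=> [x|x] //=; rewrite /padded_adj adj_irr. Qed.

Lemma padded_deg x : #|nbr padded_adj x| <= Delta.
Proof.
case: H_fam => _ _ deg; case: x => [x|i]; last first.
  by rewrite (_ : nbr _ _ = set0) ?cards0 //; apply/setP=> -[y|y]; rewrite !inE.
apply: leq_trans (deg x); rewrite -(card_imset _ (@inl_inj V 'I_(n - #|V|))).
apply/subset_leq_card/subsetP=> -[y|y]; rewrite !inE //= => xy.
by apply: imset_f; rewrite inE.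
Qed.

Lemma padded_sparse S : degsum padded_adj S S <= 2 * d * #|S|.
Proof.
case: H_fam => _ [v [[g vK gK] back_le]] _.
pose r (x : padded) : nat := if x is inl u then g u else 0.
apply: (@ranked_sparse _ _ r) => [||x]; first exact: padded_sym.
  move=> [x|x] [y|y] //= xy; apply: contraTneq xy => /val_inj E.
  by rewrite -(gK x) E gK /padded_adj adj_irr.
case: x => [x|i]; last first.
  by rewrite (_ : [set _ | _] = set0) ?cards0 //; apply/setP=> -[y|y]; rewrite !inE.
apply: leq_trans (back_le (g x)).
rewrite gK -(card_imset _ (@inl_inj V 'I_(n - #|V|))).
apply/subset_leq_card/subsetP=> -[y|y]; rewrite !inE //= => /andP[xy lt].
have {}xy : adj H x y by [].
apply: imset_f; rewrite !inE xy /=; apply/imsetP; exists (g y); rewrite ?gK // inE; exact: lt.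
Qed.
End Reduction.

Section Zones.
Variable n : nat.
Local Open Scope nat_scope.

Definition zone a l : {set 'I_n} := [set v : 'I_n | a <= v < a + l].

Lemma card_zone a l : a + l <= n -> #|zone a l| = l.
Proof.
move=> le; have lt (i : 'I_l) : a + i < n by apply: leq_trans le; rewrite ltn_add2l.
rewrite -[RHS]card_ord -[RHS](card_imset _ (f := fun i => Ordinal (lt i))); last first.
  by move=> i j /(congr1 val)/= /addnI/val_inj.
apply: eq_card => v; rewrite inE; apply/idP/imsetP=> [/andP[av va]|[i _ ->]].
  have iv : v - a < l by rewrite ltn_subLR.
  by exists (Ordinal iv) => //; apply: val_inj; rewrite /= subnKC.
by rewrite /= leq_addr ltn_add2l ltn_ord.
Qed.

Lemma zone_disjoint a l a' l' : a + l <= a' -> [disjoint zone a l & zone a' l'].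
Proof.
move=> le; rewrite -setI_eq0; apply/eqP/setP=> v; rewrite !inE.
by apply/negP=> /andP[/andP[_ lt] /andP[ge _]]; lia.
Qed.

Lemma zone_disjoint_step a l i j : i != j ->
  [disjoint zone (a + i * l) l & zone (a + j * l) l].
Proof.
by case: ltngtP => // [ij|ji] _; [|rewrite disjoint_sym];
   apply: zone_disjoint; rewrite -addnA -mulSnr leq_add2l leq_mul2r ?ij ?ji orbT.
Qed.
End Zones.

Section FixedN.
Variables (R : realType) (n : nat) (p : R) (d Delta t k0 m : nat).
Hypothesis p01 : 0 <= p <= 1.
Local Notation eta := ((n.+1%:R : R)^-1).
Local Notation K := (block_size d Delta).
Local Notation M := (layer_factor d Delta).
Hypothesis d_gt0 : (0 < d)%N.
Hypothesis t_gt0 : (0 < t)%N.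
Hypothesis t_small : (1 - p ^+ (2 * d)) ^+ t <= eta ^+ (2 * d + 5).
Hypothesis room : (2 * t * k0.+1 + 2 * K * (m + K * t) <= n)%N.
Hypothesis m_big : (2 * t * k0.+1 + 2 * t <= m)%N.
Hypothesis m_small : (sparsity_const d Delta * (2 * m) <= n)%N.
Hypothesis layers_enough : (n * M.-1 ^ k0 < M ^ k0)%N.

Let N := (m + K * t)%N.

(* Consecutive intervals of 'I_n: the k0 + 1 reserved zones, then for each b the
   K parts in which the successive vertices of the copies are found. *)
Let Rz i := zone n (0 + i * (2 * t)) (2 * t).
Let Pz (b : bool) (i : 'I_K) := zone n (2 * t * k0.+1 + (b * K + i) * N) N.
Let Zz b := \bigcup_i Pz b i.

Let K_gt0 : (0 < K)%N. Proof. by []. Qed.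

Lemma m_le_n : (m <= n)%N. Proof. by have := K_gt0; nia. Qed.

Lemma Pz_index_lt (b : bool) (i : 'I_K) : (b * K + i < 2 * K)%N.
Proof. by have := ltn_ord i; case: b => /=; lia. Qed.

Lemma card_Pz b i : #|Pz b i| = N.
Proof.
apply: card_zone; apply: leq_trans room; rewrite -addnA leq_add2l -/N -mulSnr.
by rewrite leq_mul2r (Pz_index_lt b i) orbT.
Qed.

Lemma card_Rz i : (i <= k0)%N -> #|Rz i| = (2 * t)%N.
Proof.
move=> le; apply: card_zone; apply: leq_trans room; rewrite add0n -mulSnr mulnC.
by apply: leq_trans (leq_addr _ _); rewrite leq_mul2l ltnS le orbT.
Qed.

Lemma Rz_Pz i b j : (i <= k0)%N -> [disjoint Rz i & Pz b j].
Proof.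
move=> le; apply: zone_disjoint; rewrite add0n -mulSnr mulnC.
by apply: leq_trans (leq_addr _ _); rewrite leq_mul2l ltnS le orbT.
Qed.

(** The number of types that the union bound runs over does not depend on n. *)
Lemma Pr_not_universal :
  Pr p (fun G : sgraph 'I_n => ~~ `[< universal (bounded_degenerate n d Delta) G >])
    <= (2 + 2 * #|block_type K|)%:R * eta.
Proof.
have s2 : (2 <= 2 * d)%N by rewrite leq_pmulr.
have tn : (t <= n)%N by apply: leq_trans m_le_n; lia.
have v0 : 'I_n by apply: (Ordinal (leq_trans t_gt0 tn)).
have eta0 : 0 < eta by rewrite invr_gt0 ltr0n.
have eta1 : eta <= 1 by rewrite invf_le1 ?ltr0n // ler1n.
have etaX k : eta ^+ k.+1 <= eta.
  by rewrite -[leRHS]expr1; apply: ler_wiXn2l => //; apply: ltW.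
pose A1 (G : sgraph 'I_n) := [exists i : 'I_k0.+1 in setT,
  ~~ `[< expands_into (adj G) (2 * d) t (Rz i) >]].
pose A2 (G : sgraph 'I_n) := ~~ `[< well_joined (adj G) (2 * d) t >].
pose noc (x : block_type K * bool) (G : sgraph 'I_n) :=
  [exists c : {ffun 'I_m * 'I_K -> 'I_n}, is_copies (adj G) (Zz x.2) x.1 c] &&
  ~~ `[< exists c, @copy_system _ (adj G) K m t (Zz x.2) x.1 c >].
pose A3 (G : sgraph 'I_n) := [exists x in [set x : block_type K * bool |
  valid_type (2 * d) x.1], noc x G].
apply: le_trans (_ : Pr p (predU (predU A1 A2) A3) <= _).
  apply: Pr_mono => // G; apply: contraNT; rewrite /= !negb_or => /andP[/andP[G1 G2] G3].
  have {}G2 : well_joined (adj G) (2 * d) t by move: G2; rewrite negbK => /asboolP.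
  apply/asboolP=> V H HH.
  have [|||||||||||f [f_inj fP]] := @spanning_embedding (padded n V) 'I_n (@padded_adj n V H)
      (adj G) d Delta t k0 m (@padded_sym n V H) (@padded_irr n V H) (@adj_sym n G)
      (padded_deg HH) (padded_sparse HH) _ Rz Zz.
  - by rewrite card_ord (card_padded HH).
  - by move=> i j _ _ ij; apply: zone_disjoint_step.
  - by move=> i b le; apply: bigcup_disjoint => j _; apply: Rz_Pz.
  - apply: bigcup_disjoint => i _; rewrite disjoint_sym; apply: bigcup_disjoint => j _.
    apply: zone_disjoint_step; have := ltn_ord i; have := ltn_ord j; lia.
  - rewrite (eq_bigr (fun=> 2 * t)%N) => [|i _]; last by rewrite card_Rz // -ltnS.
    by rewrite sum_nat_const card_ord; lia.
  - move=> i le; have := G1; rewrite negb_exists => /forallP/(_ (Ordinal (le : (i < k0.+1)%N))).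
    by rewrite inE /= negbK => /asboolP.
  - exact: G2.
  - move=> tau b tv; have := G3; rewrite negb_exists => /forallP/(_ (tau, b)).
    rewrite inE tv /= /noc => /nandP[/negP noc1|/negPn/asboolP//]; case: noc1.
    apply/existsP.
    apply: (copies_exist v0 (@adj_sym n G) G2 tv (P := Pz b)).
      by move=> i i' ii'; apply: zone_disjoint_step; rewrite eqn_add2l.
    by move=> i; rewrite card_Pz.
  - by rewrite (card_padded HH).
  - by lia.
  - by rewrite (card_padded HH).
  exists (fun x => f (inl x)); split; first by move=> x y /f_inj[].
  by move=> x y xy; apply: fP.
apply: le_trans (Pr_or p01 _ _) _.
apply: le_trans (lerD (Pr_or p01 _ _) (lexx _)) _.
have -> : (2 + 2 * #|block_type K|)%:R * eta =
    eta + eta + (2 * #|block_type K|)%:R * eta.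
  by rewrite natrD mulrDl mulr_natl mulr2n.
apply: lerD; first apply: lerD.
- apply: le_trans (Pr_exists_le p01 (eps := eta ^+ 3) _) _.
    move=> i _; apply: Pr_not_expands => //.
    by rewrite card_Rz // -ltnS.
  rewrite cardsT card_ord; apply: le_trans (etaX 1).
  apply: (@natr_eta R n k0.+1 1 2); rewrite expn1; have := m_le_n; nia.
- apply: le_trans (etaX 3); exact: Pr_not_joined.
- apply: le_trans (Pr_exists_le p01 (eps := eta ^+ 3) _) _.
    move=> [tau b]; rewrite inE /= => tv; apply: (@Pr_no_copy_system R n p (2 * d) t) => //.
    + by apply: leq_trans m_big; rewrite mulnS; lia.
    + exact: m_le_n.
  apply: ler_pM => //; first by rewrite exprn_ge0 // ltW.
  rewrite ler_nat; apply: leq_trans (max_card _) _.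
  by rewrite card_prod card_bool mulnC.
Qed.
End FixedN.

From mathcomp Require Import all_classical all_reals all_analysis.
From mathcomp Require Import ring lra zify.
Import numFieldNormedType.Exports.

Local Open Scope classical_set_scope.
Local Open Scope ring_scope.

(** * The choice of parameters *)

Lemma one_sub_exp_le (R : realType) (q : R) (t : nat) :
  0 <= q <= 1 -> (1 - q) ^+ t <= expR (- (q * t%:R)).
Proof.
case/andP=> q0 q1; rewrite -mulNr expRM_natr; apply: lerXn2r.
- by rewrite nnegrE subr_ge0.
- by rewrite nnegrE expR_ge0.
- exact: expR_ge1Dx.
Qed.

(** If k > M ln n then (1 - 1 / M) ^ k <= exp (- k / M) < 1 / n. *)
Lemma layer_count (R : realType) (n M : nat) : (0 < n)%N -> (0 < M)%N ->
  (n * M.-1 ^ (Num.truncn (M%:R * ln (n%:R : R))).+1 < M ^ (Num.truncn (M%:R * ln (n%:R : R))).+1)%N.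
Proof.
move=> n0 M0; set k := (Num.truncn _).+1.
have nR : 0 < n%:R :> R by rewrite ltr0n.
have MR : 0 < M%:R :> R by rewrite ltr0n.
have lnk : ln (n%:R : R) < k%:R / M%:R.
  by rewrite ltr_pdivlMr // mulrC /k truncnS_gt.
have q01 : 0 <= (M%:R^-1 : R) <= 1 by rewrite invr_ge0 ler0n invf_le1 // ler1n.
have ME : M.-1%:R = M%:R * (1 - M%:R^-1) :> R.
  by rewrite mulrBr mulr1 mulfV ?gt_eqF // -{2}(prednK M0) -natr1 addrK.
rewrite -(ltr_nat R) natrM !natrX ME exprMn mulrCA gtr_pMr ?exprn_gt0 //.
apply: le_lt_trans (_ : n%:R * expR (- (M%:R^-1 * k%:R)) < _).
  by rewrite ler_pM2l // one_sub_exp_le.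
rewrite expRN ltr_pdivrMr ?expR_gt0 // mul1r -[ltLHS]lnK // ltr_expR mulrC.
exact: lnk.
Qed.

(** Here t is about b ln n / q, hence at most of order n / ln^2 n, and k0 is about
M ln n. So t * k0 is at most of order n / ln n, which is below any fixed
proportion of n. *)
Lemma parameters_exist (R : realType) (n b M M0 C : nat) (q : R) :
    0 < q <= 1 -> ln (n%:R : R) ^+ 3 <= q * n%:R -> (0 < M)%N -> (0 < M0)%N ->
    (M0 * ((2 * b + 4) * (2 * M + 2 + C)))%:R <= ln (n%:R : R) ->
  exists t k0 m : nat, [/\ (0 < t)%N, (1 - q) ^+ t <= (n.+1%:R^-1) ^+ b,
    (t * (2 * k0 + C) <= m)%N, (M0 * m <= n)%N & (n * M.-1 ^ k0 < M ^ k0)%N].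
Proof.
case/andP=> q0 q1 qn Mgt0 M0gt0 big.
set l := ln (n%:R : R) in qn big *.
set B := (2 * b + 4)%N in big; set D := (2 * M + 2 + C)%N in big.
have BD_gt0 : (0 < B * D)%N by rewrite muln_gt0 /B /D addn4 addnAC addn2.
have l1 : 1 <= l by apply: le_trans big; rewrite ler1n muln_gt0 BD_gt0 M0gt0.
have l0 : 0 < l by apply: lt_le_trans l1.
have n2 : (2 <= n)%N.
  rewrite ltnNge; apply/negP=> n1; have : l <= 0 by apply: ln_le0; rewrite lern1.
  by rewrite leNgt l0.
have nR : 0 < n%:R :> R by rewrite ltr0n; apply: leq_trans n2.
have nE : n%:R = expR l by rewrite /l lnK.
have ln_n1 : ln (n.+1%:R : R) <= 2 * l.
  rewrite mulr_natl -lnXn // ler_ln ?posrE ?ltr0n ?exprn_gt0 //.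
  rewrite -natrX ler_nat; apply: leq_trans (_ : n * 2 <= _)%N; first by lia.
  by rewrite expnS expn1 leq_mul2l n2 orbT.
have nl2 : l ^+ 2 <= 4 * n%:R.
  have h : l / 2 <= expR (l / 2) by apply: le_trans (expR_ge1Dx _); rewrite lerDr.
  have -> : n%:R = expR (l / 2) ^+ 2 by rewrite -expRM_natr nE; congr expR; field.
  have : (l / 2) ^+ 2 <= expR (l / 2) ^+ 2.
    by apply: lerXn2r => //; rewrite nnegrE ?expR_ge0 // divr_ge0 ?ltW.
  by rewrite expr_div_n; lra.
have nl : l <= n%:R by rewrite nE; apply: le_trans (expR_ge1Dx _); rewrite lerDr.
pose t := (Num.truncn (b%:R * ln (n.+1%:R : R) / q)).+1.
pose k0 := (Num.truncn (M%:R * l)).+1.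
have ln1_ge0 : 0 <= ln (n.+1%:R : R) by apply: ln_ge0; rewrite ler1n.
have t_gt : b%:R * ln (n.+1%:R : R) / q < t%:R by apply: truncnS_gt.
have t_le : t%:R <= b%:R * ln (n.+1%:R : R) / q + 1.
  by rewrite /t -(natr1 (Num.truncn _)) lerD2r truncn_le // divr_ge0 ?mulr_ge0 // ltW.
have k_le : k0%:R <= M%:R * l + 1.
  by rewrite /k0 -(natr1 (Num.truncn _)) lerD2r truncn_le mulr_ge0 // ltW.
exists t, k0, (n %/ M0)%N; split=> //.
- apply: le_trans (one_sub_exp_le _ _) _; first by rewrite ltW.
  rewrite exprVn expRN lef_pV2 ?posrE ?exprn_gt0 ?ltr0n ?expR_gt0 //.
  rewrite -[leLHS]lnK ?posrE ?exprn_gt0 ?ltr0n // lnXn ?ltr0n // ler_expR.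
  by move: t_gt; rewrite ltr_pdivrMr // mulr_natl [_ * q]mulrC => /ltW.
- have tB : t%:R * l ^+ 2 <= B%:R * n%:R.
    have h1 : b%:R * ln (n.+1%:R : R) / q * l ^+ 3 <= b%:R * ln (n.+1%:R : R) * n%:R.
      rewrite -mulrA ler_wpM2l ?mulr_ge0 // mulrC ler_pdivrMr //.
      by rewrite [n%:R * q]mulrC.
    have h2 : b%:R * ln (n.+1%:R : R) * n%:R <= 2 * b%:R * n%:R * l.
      have : b%:R * n%:R * ln (n.+1%:R : R) <= b%:R * n%:R * (2 * l).
        by rewrite ler_wpM2l // mulr_ge0.
      by lra.
    have h3 : b%:R * ln (n.+1%:R : R) / q * l ^+ 2 <= 2 * b%:R * n%:R.
      rewrite -(ler_pM2r l0) -[leLHS]mulrA -exprSr; exact: le_trans h1 h2.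
    have : t%:R * l ^+ 2 <= (b%:R * ln (n.+1%:R : R) / q + 1) * l ^+ 2.
      by rewrite ler_wpM2r // exprn_ge0 // ltW.
    rewrite mulrDl mul1r /B natrD natrM mulrDl; move: h3 nl2; lra.
  have kD : (2 * k0 + C)%:R <= D%:R * l.
    have : C%:R * 1 <= C%:R * l by rewrite ler_wpM2l.
    rewrite /D !natrD !natrM !mulrDl mulr1; move: k_le l1; lra.
  have tk : (t * (2 * k0 + C))%:R * l <= (B * D)%:R * n%:R.
    rewrite -(ler_pM2r l0) -mulrA -expr2 natrM mulrAC.
    apply: le_trans (_ : (B%:R * n%:R) * (D%:R * l) <= _).
      by apply: ler_pM => //; rewrite ?mulr_ge0 ?exprn_ge0 // ltW.
    by rewrite natrM; lra.
  rewrite leq_divRL // -(ler_nat R).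
  have BD0 : 0 < (B * D)%:R :> R by rewrite ltr0n.
  rewrite -(ler_pM2r BD0) mulrC [leRHS]mulrC; apply: le_trans tk.
  by rewrite [(_ * M0)%:R]natrM mulrCA ler_wpM2l // -natrM mulnC.
- by rewrite mulnC leq_trunc_div.
- by apply: layer_count => //; apply: leq_trans n2.
Qed.

Lemma whp_of_bound (R : realType) (p : nat -> R) (A : forall n, sgraph 'I_n -> Prop) (C : R) :
  (forall n, 0 <= p n <= 1) ->
  (\forall n \near \oo, Pr (p n) (fun G => ~~ `[< A n G >]) <= C * n.+1%:R^-1) ->
  gnp_whp p A.
Proof.
move=> p01 bound; rewrite /gnp_whp.
have lim1 : (1 - C * n.+1%:R^-1 : R) @[n --> \oo] --> (1 : R).
  rewrite -[X in _ --> X]subr0 -(mulr0 C).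
  apply: cvgB; first exact: cvg_cst.
  apply: cvgMr; exact: cvg_harmonic.
apply: (squeeze_cvgr _ lim1 (cvg_cst _)); near=> n.
have -> : gnp_prob (p n) (A n) = 1 - Pr (p n) (fun G => ~~ `[< A n G >]).
  by rewrite (PrC (p n) (fun G => `[< A n G >])) opprB addrC subrK.
rewrite lerD2l lerN2 gerBl Pr_ge0 // andbT; near: n; exact: bound.
Unshelve. all: by end_near. Qed.

(* The lower bound on p is required for all large n only: around n = 20 its
   right-hand side exceeds 1, so no p with values in [0, 1] satisfies it for
   every n. *)
Theorem theorem1p1 (R : realType) (d Delta : nat) (p : nat -> R)
  (d_gt0 : (0 < d)%N) (d_le_Delta : (d <= Delta)%N)
  (p01 : forall n : nat, 0 <= p n <= 1)
  (p_ge : \forall n \near \oo,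
     (n%:R^-1 * ln (n%:R : R) ^+ 3) `^ (2 * d%:R)^-1 <= p n) :
  gnp_whp p (fun n G => universal (bounded_degenerate n d Delta) G).
Proof.
pose K := block_size d Delta; pose M := layer_factor d Delta.
(* M0 m <= n makes room for the copies in both zones and for the selection of
   2 m blocks; t (2 k0 + C) <= m makes the reserved zones and the copies that
   partial_copies spoils negligible. *)
pose M0 := (2 * K + 1 + 2 * sparsity_const d Delta)%N.
pose C := (2 * K ^ 2 + 4)%N; pose b := (2 * d + 5)%N.
pose big := (M0 * ((2 * b + 4) * (2 * M + 2 + C)))%N.
apply: (whp_of_bound (C := (2 + 2 * #|block_type K|)%:R)) => //; near=> n.
have n_big : expR (big%:R : R) <= n%:R by near: n; exact: nbhs_infty_ger.
have nR : 0 < n%:R :> R by apply: lt_le_trans n_big; exact: expR_gt0.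
have l_big : big%:R <= ln (n%:R : R) by rewrite -ler_expR lnK.
have [q0 qn] : 0 < p n ^+ (2 * d) /\ ln (n%:R : R) ^+ 3 <= p n ^+ (2 * d) * n%:R.
  set x := n%:R^-1 * ln (n%:R : R) ^+ 3.
  have x0 : 0 < x.
    rewrite mulr_gt0 ?invr_gt0 // exprn_gt0 //; apply: lt_le_trans l_big.
    by rewrite ltr0n /big 2!muln_gt0 /M0 /C; apply/and3P; split; lia.
  have xp : x `^ (2 * d%:R)^-1 <= p n by rewrite /x; near: n; exact: p_ge.
  have xq : x <= p n ^+ (2 * d).
    have -> : x = (x `^ (2 * d%:R)^-1) ^+ (2 * d).
      rewrite -powR_mulrn ?powR_ge0 // -powRrM natrM mulVf ?powRr1 // ?ltW //.
      by rewrite mulf_neq0 // pnatr_eq0 -lt0n.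
    by apply: lerXn2r; rewrite ?nnegrE ?powR_ge0 //; case/andP: (p01 n).
  split; first exact: lt_le_trans xq.
  by rewrite -ler_pdivrMr // mulrC.
have [//|||t [k0 [m [t0 tS tk mn lay]]]] := @parameters_exist R n b M M0 C _ _ qn _ _ l_big.
- by rewrite q0 /=; case/andP: (p01 n) => ? ?; rewrite exprn_ile1.
- by rewrite muln_gt0 addn2 expn_gt0.
- by rewrite /M0; lia.
apply: (@Pr_not_universal R n (p n) d Delta t k0 m) => //.
- have -> : (2 * t * k0.+1 + 2 * K * (m + K * t) = t * (2 * k0 + (2 * K ^ 2 + 2)) + 2 * K * m)%N.
    by rewrite expnS expn1; lia.
  apply: leq_trans mn; apply: leq_trans (_ : m + 2 * K * m <= _)%N.
    rewrite leq_add2r; apply: leq_trans tk; rewrite leq_mul2l /C; lia.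
  by rewrite -mulSn leq_mul2r /M0; lia.
- have -> : (2 * t * k0.+1 + 2 * t = t * (2 * k0 + 4))%N by lia.
  by apply: leq_trans tk; rewrite leq_mul2l /C; lia.
- apply: leq_trans mn; rewrite mulnCA mulnA leq_mul2r /M0; lia.
Unshelve. all: by end_near.
Qed.
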